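(* Let $A$ be a separable C*-algebra, $G$ be an amenable, residually finite group satisfying the (VRC) property, and let $\alpha:G\to\mathrm{Aut}(A)$ be an action of $G$ on $A$. If $\dim_{\mathrm{Rok}}(\alpha)<\infty$, then $\alpha$ is properly outer.
   Context: All groups are countable and discrete. A subgroup $H$ of $G$ is a virtual retract of $G$ if there are a finite index subgroup $K$ of $G$ containing $H$ and a group homomorphism $\rho:K\to H$ restricting to the identity on $H$. $G$ has property (VRC) if every cyclic subgroup of $G$ is a virtual retract of $G$. Proper outerness: for an automorphism $\alpha$ of a C*-algebra $A$, $\mathrm{Sp}(\alpha)\subset\mathbb{T}$ denotes its Arveson spectrum. $H^\alpha(A)$ is the set of all non-zero $\alpha$-invariant hereditary C*-subalgebras of $A$, and $H^\alpha_{\mathrm{B}}(A)$ is the set of those $D\in H^\alpha(A)$ for which the closed ideal of $A$ generated by $D$ is an essential ideal of $A$. The Borchers spectrum is $\Gamma_{\mathrm{B}}(\alpha)=\bigcap_{D\in H^\alpha_{\mathrm{B}}(A)}\mathrm{Sp}(\alpha|_D)$. An automorphism $\alpha$ of a separable C*-algebra $A$ is properly outer if $\Gamma_{\mathrm{B}}(\alpha|_D)\neq\{1\}$ for each $D\in H^\alpha(A)$. An action $\alpha:G\to\mathrm{Aut}(A)$ is properly outer if $\alpha_g$ is properly outer for each non-identity $g\in G$. Elements $a,b$ of a C*-algebra are orthogonal, $a\perp b$, if $ab=ba=a^*b=b^*a=0$. A contractive completely positive (c.c.p.) map has order zero if it sends orthogonal elements to orthogonal elements. Central sequence algebra: $A_\infty:=\ell^\infty(\mathbb{N},A)/c_0(\mathbb{N},A)$,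 with $A$ embedded as constant sequences. For a C*-subalgebra $D\subset A$, $A_\infty\cap D'=\{x\in A_\infty: xd=dx\ \forall d\in D\}$, $\mathrm{Ann}(D,A_\infty)=\{x\in A_\infty: xd=dx=0\ \forall d\in D\}$, and $F(D,A):=(A_\infty\cap D')/\mathrm{Ann}(D,A_\infty)$, which is unital if $D$ is $\sigma$-unital. If $D$ is invariant under an action $\alpha$ of $G$ on $A$, $\widetilde{\alpha}_\infty$ denotes the induced action of $G$ on $F(D,A)$. Rokhlin dimension of an action $\alpha:G\to\mathrm{Aut}(A)$ of a residually finite group $G$: for a subgroup $H\leq G$ of finite index, $\sigma^H$ is the action of $G$ on $C(G/H)$ given by $\sigma^H_t(f)(gH)=f(t^{-1}gH)$. $\dim_{\mathrm{Rok}}(\alpha,H)$ is the least integer $d\ge 0$ such that for every separable $\alpha$-invariant C*-subalgebra $D\subset A$ there exist $(d+1)$ $G$-equivariant c.c.p. order zero maps $\varphi_0,\ldots,\varphi_d:(C(G/H),\sigma^H)\to(F(D,A),\widetilde{\alpha}_\infty)$ with $\sum_{\ell=0}^d\varphi_\ell(1_{C(G/H)})=1_{F(D,A)}$ (and $+\infty$ if no such $d$ exists). $\dim_{\mathrm{Rok}}(\alpha)=\sup_H\dim_{\mathrm{Rok}}(\alpha,H)$, the supremum over all finite index subgroups $H$ of $G$. *)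

(* Defs.v *)
From HB Require Import structures.
From mathcomp Require Import all_boot all_order all_algebra.
From mathcomp Require Import all_classical all_reals all_analysis.
From mathcomp Require Import complex.

Set Implicit Arguments.
Unset Strict Implicit.
Unset Printing Implicit Defensive.

Import Order.TTheory GRing.Theory Num.Theory.
Import numFieldNormedType.Exports.

Local Open Scope classical_set_scope.
Local Open Scope complex_scope.
Local Open Scope ring_scope.

(* The real numbers are an arbitrary [R : realType], the complex numbers are
   [R[i]]; norms of normed spaces over [R[i]] take (real) values in [R[i]]. *)

Declare Scope star_scope.
Local Open Scope star_scope.

Reserved Notation "x ** y" (at level 40, left associativity).

HB.mixin Record isStarAlg (R : realType) B of GRing.Lmodule R[i] B := {
  amul : B -> B -> B;
  adj : B -> B;
  amulA : associative amul;
  amulDl : left_distributive amul +%R;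
  amulDr : right_distributive amul +%R;
  amulZl : forall (k : R[i]) x y, amul (k *: x) y = k *: amul x y;
  amulZr : forall (k : R[i]) x y, amul x (k *: y) = k *: amul x y;
  adjK : involutive adj;
  adjD : {morph adj : x y / x + y};
  adjZ : forall (k : R[i]) x, adj (k *: x) = k^* *: adj x;
  adjM : forall x y, adj (amul x y) = amul (adj y) (adj x)
}.

#[short(type="starAlgType")]
HB.structure Definition StarAlg (R : realType) :=
  {B of isStarAlg R B & GRing.Lmodule R[i] B}.

Notation "x ** y" := (amul x y) : star_scope.

HB.mixin Record isCStarAlg (R : realType) A
    of StarAlg R A & CompleteNormedModule R[i] A := {
  norm_amul : forall x y : A, `|x ** y| <= `|x| * `|y|;
  norm_adjM : forall x : A, `|adj x ** x| = `|x| ^+ 2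
}.

#[short(type="cstarAlgType")]
HB.structure Definition CStarAlg (R : realType) :=
  {A of isCStarAlg R A & StarAlg R A & CompleteNormedModule R[i] A}.

Section StarAlgTheory.
Variables (R : realType) (B : starAlgType R).
Implicit Types x y : B.

Lemma amul0r x : 0 ** x = 0.
Proof. by rewrite -(scale0r (0 : B)) amulZl !scale0r. Qed.

Lemma amulr0 x : x ** 0 = 0.
Proof. by rewrite -(scale0r (0 : B)) amulZr !scale0r. Qed.

Lemma amulNr x y : (- x) ** y = - (x ** y).
Proof. by rewrite -scaleN1r amulZl scaleN1r. Qed.

Lemma amulrN x y : x ** (- y) = - (x ** y).
Proof. by rewrite -scaleN1r amulZr scaleN1r. Qed.

Lemma amulBl x y z : (x - y) ** z = x ** z - y ** z.
Proof. by rewrite amulDl amulNr. Qed.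

Lemma amulBr x y z : z ** (x - y) = z ** x - z ** y.
Proof. by rewrite amulDr amulrN. Qed.

Lemma adj0 : adj (0 : B) = 0.
Proof. by rewrite -(scale0r (0 : B)) adjZ rmorph0 !scale0r. Qed.

Lemma adjN x : adj (- x) = - adj x.
Proof. by rewrite -scaleN1r adjZ rmorphN rmorph1 scaleN1r. Qed.

Lemma adjB x y : adj (x - y) = adj x - adj y.
Proof. by rewrite adjD adjN. Qed.

End StarAlgTheory.

Section Regular.
Variable R : realType.
Let C : Type := R[i]^o.
Let cmul (x y : C) : C := (x : R[i]) * y.
Let cadj (x : C) : C := (x : R[i])^*.
Let cmulA : associative cmul. Proof. exact: mulrA. Qed.
Let cmulDl : left_distributive cmul +%R. Proof. exact: mulrDl. Qed.
Let cmulDr : right_distributive cmul +%R. Proof. exact: mulrDr. Qed.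
Let cmulZl (k : R[i]) x y : cmul (k *: x) y = k *: cmul x y.
Proof. exact: esym (mulrA _ _ _). Qed.
Let cmulZr (k : R[i]) x y : cmul x (k *: y) = k *: cmul x y.
Proof. exact: mulrCA. Qed.
Let cadjK : involutive cadj. Proof. exact: conjcK. Qed.
Let cadjD : {morph cadj : x y / x + y}. Proof. by move=> x y; exact: rmorphD. Qed.
Let cadjZ (k : R[i]) x : cadj (k *: x) = k^* *: cadj x. Proof. exact: rmorphM. Qed.
Let cadjM x y : cadj (cmul x y) = cmul (cadj y) (cadj x).
Proof. by rewrite /cmul mulrC; exact: rmorphM. Qed.

HB.instance Definition _ := isStarAlg.Build R R[i]^o
  cmulA cmulDl cmulDr cmulZl cmulZr cadjK cadjD cadjZ cadjM.

End Regular.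

Section Functions.
Variables (R : realType) (T : Type) (B : starAlgType R).
Let fmul (f g : T -> B) : T -> B := fun t => f t ** g t.
Let fadj (f : T -> B) : T -> B := fun t => adj (f t).
Let fmulA : associative fmul.
Proof. by move=> f g h; apply/funext => t; exact: amulA. Qed.
Let fmulDl : left_distributive fmul +%R.
Proof. by move=> f g h; apply/funext => t; exact: amulDl. Qed.
Let fmulDr : right_distributive fmul +%R.
Proof. by move=> f g h; apply/funext => t; exact: amulDr. Qed.
Let fmulZl (k : R[i]) f g : fmul (k *: f) g = k *: fmul f g.
Proof. by apply/funext => t; exact: amulZl. Qed.
Let fmulZr (k : R[i]) f g : fmul f (k *: g) = k *: fmul f g.
Proof. by apply/funext => t; exact: amulZr. Qed.
Let fadjK : involutive fadj.
Proof. by move=> f; apply/funext => t; exact: adjK. Qed.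
Let fadjD : {morph fadj : x y / x + y}.
Proof. by move=> f g; apply/funext => t; exact: adjD. Qed.
Let fadjZ (k : R[i]) f : fadj (k *: f) = k^* *: fadj f.
Proof. by apply/funext => t; exact: adjZ. Qed.
Let fadjM f g : fadj (fmul f g) = fmul (fadj g) (fadj f).
Proof. by apply/funext => t; exact: adjM. Qed.

HB.instance Definition _ := isStarAlg.Build R (T -> B)
  fmulA fmulDl fmulDr fmulZl fmulZr fadjK fadjD fadjZ fadjM.

End Functions.

(* With these two instances [T -> R[i]^o], for [T] finite, is the *-algebra C(T)
   of a finite discrete space. *)

Record starSub (R : realType) (B : starAlgType R) := StarSub {
  starSub_set :> B -> Prop;
  starSub0 : starSub_set 0;
  starSubD : forall x y, starSub_set x -> starSub_set y -> starSub_set (x + y);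
  starSubZ : forall (k : R[i]) x, starSub_set x -> starSub_set (k *: x);
  starSubM : forall x y, starSub_set x -> starSub_set y -> starSub_set (x ** y);
  starSub_adj : forall x, starSub_set x -> starSub_set (adj x)
}.

Record starIdeal (R : realType) (B : starAlgType R) := StarIdeal {
  starIdeal_set :> B -> Prop;
  starIdeal0 : starIdeal_set 0;
  starIdealD : forall x y,
    starIdeal_set x -> starIdeal_set y -> starIdeal_set (x + y);
  starIdealZ : forall (k : R[i]) x, starIdeal_set x -> starIdeal_set (k *: x);
  starIdealMl : forall x y, starIdeal_set y -> starIdeal_set (x ** y);
  starIdealMr : forall x y, starIdeal_set x -> starIdeal_set (x ** y);
  starIdeal_adj : forall x, starIdeal_set x -> starIdeal_set (adj x)
}.

Section SubType.
Variables (R : realType) (B : starAlgType R) (S : starSub B).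

Definition starSub_pred : {pred B} := [pred x | `[< S x >]].

Record subAlg := SubAlg { subAlg_val : B; subAlgP : subAlg_val \in starSub_pred }.

HB.instance Definition _ := [isSub for subAlg_val].
HB.instance Definition _ := [Choice of subAlg by <:].

Lemma starSub_predP x : reflect (S x) (x \in starSub_pred).
Proof. exact: asboolP. Qed.

Lemma starSub_submod : submod_closed starSub_pred.
Proof.
split; first by apply/starSub_predP; exact: starSub0.
move=> k x y /starSub_predP Sx /starSub_predP Sy; apply/starSub_predP.
by apply: starSubD => //; exact: starSubZ.
Qed.

HB.instance Definition _ := GRing.isSubmodClosed.Build _ _ starSub_pred
  starSub_submod.
HB.instance Definition _ := [SubChoice_isSubLmodule of subAlg by <:].

Definition mkSub (x : B) (Sx : S x) : subAlg := SubAlg (introT (starSub_predP x) Sx).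

Lemma subAlg_in (x : subAlg) : S (val x).
Proof. exact/starSub_predP/(valP x). Qed.

Let smul (x y : subAlg) := mkSub (starSubM (subAlg_in x) (subAlg_in y)).
Let sadj (x : subAlg) := mkSub (starSub_adj (subAlg_in x)).
Let smulA : associative smul.
Proof. by move=> x y z; apply/val_inj; exact: amulA. Qed.
Let smulDl : left_distributive smul +%R.
Proof. by move=> x y z; apply/val_inj; exact: amulDl. Qed.
Let smulDr : right_distributive smul +%R.
Proof. by move=> x y z; apply/val_inj; exact: amulDr. Qed.
Let smulZl (k : R[i]) x y : smul (k *: x) y = k *: smul x y.
Proof. by apply/val_inj; exact: amulZl. Qed.
Let smulZr (k : R[i]) x y : smul x (k *: y) = k *: smul x y.
Proof. by apply/val_inj; exact: amulZr. Qed.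
Let sadjK : involutive sadj.
Proof. by move=> x; apply/val_inj; exact: adjK. Qed.
Let sadjD : {morph sadj : x y / x + y}.
Proof. by move=> x y; apply/val_inj; exact: adjD. Qed.
Let sadjZ (k : R[i]) x : sadj (k *: x) = k^* *: sadj x.
Proof. by apply/val_inj; exact: adjZ. Qed.
Let sadjM x y : sadj (smul x y) = smul (sadj y) (sadj x).
Proof. by apply/val_inj; exact: adjM. Qed.

HB.instance Definition _ := isStarAlg.Build R subAlg
  smulA smulDl smulDr smulZl smulZr sadjK sadjD sadjZ sadjM.

Lemma val_amul (x y : subAlg) : val (x ** y) = val x ** val y.
Proof. by []. Qed.

Lemma val_adj (x : subAlg) : val (adj x) = adj (val x).
Proof. by []. Qed.

End SubType.

Section QuotientType.
Variables (R : realType) (B : starAlgType R) (I : starIdeal B).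

Definition starIdeal_pred : {pred B} := [pred x | `[< I x >]].

Lemma starIdeal_predP x : reflect (I x) (x \in starIdeal_pred).
Proof. exact: asboolP. Qed.

Lemma starIdealB x y : I x -> I y -> I (x - y).
Proof.
by move=> Ix Iy; apply: starIdealD => //; rewrite -scaleN1r; exact: starIdealZ.
Qed.

Lemma starIdeal_zmod : zmod_closed starIdeal_pred.
Proof.
split; first by apply/starIdeal_predP; exact: starIdeal0.
move=> x y /starIdeal_predP Ix /starIdeal_predP Iy.
exact/starIdeal_predP/starIdealB.
Qed.

HB.instance Definition _ := GRing.isZmodClosed.Build _ starIdeal_pred
  starIdeal_zmod.

Definition quotAlg : Type := {ideal_quot starIdeal_pred}.
HB.instance Definition _ := GRing.Zmodule.on quotAlg.

Definition qpi (x : B) : quotAlg := \pi_({ideal_quot starIdeal_pred})%qT x.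
Definition qrepr (q : quotAlg) : B := repr (q : {ideal_quot starIdeal_pred}).

Lemma qreprK q : qpi (qrepr q) = q. Proof. exact: reprK. Qed.

Lemma qpi_eq x y : qpi x = qpi y <-> I (x - y).
Proof.
split; first by move/eqP; rewrite -Quotient.idealrBE => /starIdeal_predP.
by move=> Ixy; apply/eqP; rewrite -Quotient.idealrBE; exact/starIdeal_predP.
Qed.

Lemma qrepr_sub x : I (qrepr (qpi x) - x).
Proof. by apply/qpi_eq; rewrite qreprK. Qed.

Lemma qpiD x y : qpi (x + y) = qpi x + qpi y.
Proof. exact: Quotient.pi_add. Qed.

Lemma qpi0 : qpi 0 = 0.
Proof. by apply: (addrI (qpi 0)); rewrite -qpiD !addr0. Qed.

Lemma qpiB x y : qpi (x - y) = qpi x - qpi y.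
Proof. by apply: (addIr (qpi y)); rewrite -qpiD !subrK. Qed.

Let qscale (k : R[i]) (q : quotAlg) : quotAlg := qpi (k *: qrepr q).
Let qmul (p q : quotAlg) : quotAlg := qpi (qrepr p ** qrepr q).
Let qadj (q : quotAlg) : quotAlg := qpi (adj (qrepr q)).

Let qscaleE k x : qscale k (qpi x) = qpi (k *: x).
Proof. by apply/qpi_eq; rewrite -scalerBr; exact/starIdealZ/qrepr_sub. Qed.

Let qmulE x y : qmul (qpi x) (qpi y) = qpi (x ** y).
Proof.
apply/qpi_eq; rewrite -[X in X - _](subrK (x ** qrepr (qpi y))).
rewrite -amulBl -addrA -amulBr.
by apply: starIdealD; [apply: starIdealMr|apply: starIdealMl]; exact: qrepr_sub.
Qed.

Let qadjE x : qadj (qpi x) = qpi (adj x).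
Proof. by apply/qpi_eq; rewrite -adjB; exact/starIdeal_adj/qrepr_sub. Qed.

Let qscaleA a b q : qscale a (qscale b q) = qscale (a * b) q.
Proof. by rewrite -[q]qreprK !qscaleE scalerA. Qed.
Let qscale1 : left_id 1 qscale.
Proof. by move=> q; rewrite -[q]qreprK qscaleE scale1r. Qed.
Let qscaleDr : right_distributive qscale +%R.
Proof.
by move=> k p q; rewrite -[p]qreprK -[q]qreprK -qpiD !qscaleE -qpiD scalerDr.
Qed.
Let qscaleDl q : {morph qscale^~ q : a b / a + b}.
Proof. by move=> a b; rewrite -[q]qreprK !qscaleE -qpiD scalerDl. Qed.

HB.instance Definition _ := GRing.Zmodule_isLmodule.Build R[i] quotAlg
  qscaleA qscale1 qscaleDr qscaleDl.

Let qmulA : associative qmul.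
Proof.
by move=> x y z; rewrite -[x]qreprK -[y]qreprK -[z]qreprK !qmulE amulA.
Qed.
Let qmulDl : left_distributive qmul +%R.
Proof.
move=> x y z; rewrite -[x]qreprK -[y]qreprK -[z]qreprK -qpiD !qmulE.
by rewrite -qpiD amulDl.
Qed.
Let qmulDr : right_distributive qmul +%R.
Proof.
move=> x y z; rewrite -[x]qreprK -[y]qreprK -[z]qreprK -qpiD !qmulE.
by rewrite -qpiD amulDr.
Qed.
Let qmulZl (k : R[i]) x y : qmul (k *: x) y = k *: qmul x y.
Proof.
by rewrite -[x]qreprK -[y]qreprK /GRing.scale/= !(qmulE, qscaleE) amulZl.
Qed.
Let qmulZr (k : R[i]) x y : qmul x (k *: y) = k *: qmul x y.
Proof.
by rewrite -[x]qreprK -[y]qreprK /GRing.scale/= !(qmulE, qscaleE) amulZr.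
Qed.
Let qadjK : involutive qadj.
Proof. by move=> x; rewrite -[x]qreprK !qadjE adjK. Qed.
Let qadjD : {morph qadj : x y / x + y}.
Proof.
by move=> x y; rewrite -[x]qreprK -[y]qreprK -qpiD !qadjE -qpiD adjD.
Qed.
Let qadjZ (k : R[i]) x : qadj (k *: x) = k^* *: qadj x.
Proof. by rewrite -[x]qreprK /GRing.scale/= !(qadjE, qscaleE) adjZ. Qed.
Let qadjM x y : qadj (qmul x y) = qmul (qadj y) (qadj x).
Proof. by rewrite -[x]qreprK -[y]qreprK !(qadjE, qmulE) adjM. Qed.

HB.instance Definition _ := isStarAlg.Build R quotAlg
  qmulA qmulDl qmulDr qmulZl qmulZr qadjK qadjD qadjZ qadjM.

Lemma qpiZ k x : qpi (k *: x) = k *: qpi x. Proof. exact: esym (qscaleE _ _). Qed.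
Lemma qpiM x y : qpi (x ** y) = qpi x ** qpi y. Proof. exact: esym (qmulE _ _). Qed.
Lemma qpi_adj x : qpi (adj x) = adj (qpi x). Proof. exact: esym (qadjE _). Qed.

End QuotientType.

(* No unitization or spectral theory is needed: if [h] is self-adjoint with
   [`|h| < 1], then [h ** h + (1 - t) ** (1 - t) = 1] for some self-adjoint [t]
   commuting with [h], so [h] is the real part of the unitary [h + i (1 - t)];
   this identity, read on left multiplication operators, is preserved by a
   *-homomorphism. *)

Definition star_hom (R : realType) (A B : starAlgType R) (f : A -> B) :=
  [/\ forall (k : R[i]) x y, f (k *: x + y) = k *: f x + f y,
      forall x y, f (x ** y) = f x ** f y
    & forall x, f (adj x) = adj (f x)].

Section Contractive.
Variable R : realType.

Lemma ctrl_cvg (V W : normedModType R[i]) (C : R[i]) (u : nat -> V) (v : nat -> W)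
    (a : V) (b : W) : 0 < C -> (forall n, `|v n - b| <= C * `|u n - a|) ->
  u @ \oo --> a -> v @ \oo --> b.
Proof.
move=> C0 le uv; apply/cvgrPdist_lt => e e0.
move/cvgrPdist_lt : uv => /(_ (C^-1 * e)) uv.
have Ce : 0 < C^-1 * e by rewrite mulr_gt0// invr_gt0.
apply: filterS (uv Ce) => n; rewrite distrC ltr_pdivlMl// => ltn.
by rewrite distrC; exact: le_lt_trans ltn.
Qed.

Section Norm.
Variable A : cstarAlgType R.
Implicit Types (x y : A).

Lemma norm_adj x : `|adj x| = `|x|.
Proof.
have le y : `|y| <= `|adj y|.
  have [->|y0] := eqVneq y 0; first by rewrite adj0.
  by rewrite -(ler_pM2r (_ : 0 < `|y|)) ?normr_gt0// -expr2 -norm_adjM norm_amul.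
by apply/le_anti; rewrite le andbT -{2}(adjK x) le.
Qed.

Lemma norm_sa2 (h : A) : adj h = h -> `|h ** h| = `|h| ^+ 2.
Proof. by move=> hh; rewrite -{1}hh norm_adjM. Qed.

Section Sqrt.
Variables (h : A) (hsa : adj h = h) (h1 : `|h| < 1).
Let s := fix s n := if n is m.+1 then 2^-1 *: (h ** h + s m ** s m) else 0 : A.

Let s_le n : `|s n| <= `|h|.
Proof.
elim: n => [|n ih] /=; first by rewrite normr0.
have sq (x : A) : `|x| <= `|h| -> `|x ** x| <= `|h|.
  move=> xh; rewrite (le_trans (norm_amul _ _))// -[leRHS]mulr1.
  by apply: ler_pM => //; apply: le_trans xh (ltW h1).
rewrite normrZ ger0_norm ?invr_ge0// ler_pdivrMl//.
by rewrite (le_trans (ler_normD _ _))// mulr_natl mulr2n lerD// sq.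
Qed.

Let s_sa n : adj (s n) = s n.
Proof.
elim: n => [|n ih] /=; first exact: adj0.
rewrite adjZ adjD !adjM ih hsa.
by rewrite (_ : (2^-1)^* = 2^-1 :> R[i])// geC0_conj// invr_ge0.
Qed.

Let s_comm n : s n ** h = h ** s n.
Proof.
elim: n => [|n ih] /=; first by rewrite amul0r amulr0.
rewrite amulZl amulZr amulDl amulDr -!amulA ih.
by congr (_ *: (_ + _)); rewrite amulA ih amulA.
Qed.

Let s_incr n : `|s n.+1 - s n| <= `|h| ^+ n.
Proof.
elim: n => [|n ih].
  by rewrite subr0 expr0 (le_trans (s_le _))// ltW.
have -> : s n.+2 - s n.+1 =
    2^-1 *: (s n.+1 ** (s n.+1 - s n) + (s n.+1 - s n) ** s n).
  rewrite -[LHS]/(2^-1 *: (h ** h + s n.+1 ** s n.+1)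
    - 2^-1 *: (h ** h + s n ** s n)) -scalerBr amulBr amulBl.
  by congr (_ *: _); rewrite opprD addrACA subrr add0r addrA subrK.
rewrite normrZ ger0_norm ?invr_ge0// ler_pdivrMl//.
rewrite (le_trans (ler_normD _ _))// mulr_natl mulr2n lerD//.
  rewrite (le_trans (norm_amul _ _))// exprS ler_pM//.
rewrite (le_trans (norm_amul _ _))// exprSr ler_pM//.
Qed.

Lemma sa_sqrt : exists t : A, [/\ adj t = t, t ** h = h ** t
  & t + t = h ** h + t ** t].
Proof.
have [t st] : exists t : A, s @ \oo --> t.
  pose r := complex.Re `|h|.
  have rE : `|h| = r%:C by rewrite /r [RHS](RRe_real (normr_real h)).
  have r0 : 0 <= r by rewrite -lecR -rE; exact: normr_ge0.
  have r1 : r < 1 by rewrite -ltcR -rE.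
  pose u n := s n.+1 - s n.
  have su : series u = s.
    apply/funext => n; rewrite /series/= /u telescope_sumr//.
    by rewrite subr0.
  have : cauchy (series u @ \oo).
    apply/cauchy_seriesP => e e0.
    have : cauchy (series (geometric 1 r) @ \oo).
      by apply/cvg_cauchy/is_cvg_geometric_series; rewrite ger0_norm.
    have eE : (complex.Re e)%:C = e by rewrite RRe_real// gtr0_real.
    move=> /cauchy_seriesP /(_ (complex.Re e)).
    rewrite -ltcR eE => /(_ e0); apply: filterS => -[m n] /=.
    rewrite -ltcR eE; apply: le_lt_trans.
    rewrite (le_trans (ler_norm_sum _ _ _))//.
    apply: (@le_trans _ _ (\sum_(m <= k < n) r ^+ k)%:C).
      rewrite rmorph_sum/=; apply: ler_sum => k _.
      by rewrite rmorphXn/= -rE s_incr.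
    rewrite lecR (eq_bigr (geometric 1 r)) ?ler_norm// => k _.
    by rewrite /geometric/= mul1r.
  by rewrite su => /cauchy_cvgP /cvg_ex.
have h1' : 0 < 1 + `|h| :> R[i] by rewrite ltr_pwDl.
have uniq (v : nat -> A) (a b : A) : v @ \oo --> a -> v @ \oo --> b -> a = b.
  exact: cvg_unique.
exists t; split.
- apply: (uniq s) => //.
  apply: (@ctrl_cvg _ _ 1 s _ t) => // n.
  by rewrite -{1}s_sa -adjB norm_adj mul1r.
- apply: (uniq (fun n => s n ** h)).
    apply: (@ctrl_cvg _ _ (1 + `|h|) s _ t) => // n.
    rewrite -amulBl (le_trans (norm_amul _ _))// mulrC ler_wpM2r//.
    by rewrite lerDr.
  apply: (@ctrl_cvg _ _ (1 + `|h|) s _ t) => // n.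
  rewrite s_comm -amulBr (le_trans (norm_amul _ _))// ler_wpM2r//.
  by rewrite lerDr.
- apply: (uniq (fun n => s n.+1 + s n.+1)).
    have /(cvg_comp _ _ (cvg_addnr 1)) st1 := st.
    have {st1} st1 : (fun n => s n.+1) @ \oo --> t.
      by rewrite (_ : (fun n => s n.+1) = s \o addn^~ 1%N)//; apply/funext => n /=; rewrite addn1.
    exact: cvgD.
  have -> : (fun n => s n.+1 + s n.+1) = (fun n => h ** h + s n ** s n).
    apply/funext => n /=; rewrite -mulr2n -scaler_nat scalerA divff ?scale1r//.
  apply: cvgD; first exact: cvg_cst.
  apply: (@ctrl_cvg _ _ (`|h| + `|t| + 1) s _ t) => // n.
  rewrite (_ : _ - _ = s n ** (s n - t) + (s n - t) ** t); last first.
    by rewrite amulBr amulBl addrA subrK.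
  rewrite (le_trans (ler_normD _ _))// mulrDl mul1r ler_wpDr//.
  rewrite mulrDl lerD// (le_trans (norm_amul _ _))//.
    by rewrite ler_wpM2r.
  by rewrite mulrC ler_wpM2l.
Qed.

End Sqrt.

Lemma sa_le1 (k t : A) : adj k = k -> adj t = t -> t ** k = k ** t ->
  t + t = k ** k + t ** t -> `|k| <= 1.
Proof.
move=> ksa tsa tk tE.
pose v (z : R[i]) (a : A) := k ** a + z *: (a - t ** a).
have vE (z : R[i]) a : z ^* = - z -> z ^+ 2 = -1 -> `|v z a| = `|a|.
  move=> zc z2; apply/eqP; rewrite -(@eqrXn2 _ 2)// -!norm_adjM; apply/eqP.
  congr (`| _ |); rewrite /v.
  set p := k ** a; set q := a - t ** a.
  have pq : adj p ** q = adj q ** p.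
    rewrite /p /q adjB !adjM ksa tsa amulBl amulBr -!amulA.
    by rewrite (amulA k t) -tk -amulA.
  have ppqq : adj p ** p + adj q ** q = adj a ** a.
    have kE : k ** k = t + t - t ** t by rewrite tE addrK.
    rewrite /p /q adjB !adjM ksa tsa !amulBl !amulBr -!amulA.
    rewrite (amulA k k) kE amulBl amulDl amulBr amulDr -!amulA.
    set X := adj a ** (t ** a); set Y := adj a ** (t ** (t ** a)).
    set Z := adj a ** a.
    by rewrite -(addrA Z) -opprD (addrA X) [LHS]addrC subrK.
  rewrite adjD adjZ zc amulDl !amulDr !amulZl !amulZr scalerA pq.
  rewrite mulNr -expr2 z2 opprK scale1r scaleNr addrA.
  by rewrite -(addrA _ (z *: _)) subrr addr0.
have le a : `|k ** a| <= `|a|.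
  have iE : ('i : R[i]) ^* = - 'i by exact: conjCi.
  have i2 : ('i : R[i]) ^+ 2 = -1 by exact: sqrCi.
  have : `|v 'i a + v (- 'i) a| <= `|a| + `|a|.
    rewrite (le_trans (ler_normD _ _))// lerD//.
      by rewrite vE.
    by rewrite vE// ?sqrrN//; exact: etrans (rmorphN _ _) (congr1 _ iE).
  rewrite /v addrACA scaleNr subrr addr0 -mulr2n -scaler_nat normrZ normr_nat.
  by rewrite -mulr2n -[leRHS]mulr_natl ler_pM2l.
have := le k; rewrite norm_sa2// => k2.
have [->|k0] := eqVneq k 0; first by rewrite normr0.
by rewrite -(ler_pM2r (_ : 0 < `|k|)) ?normr_gt0// mul1r -expr2.
Qed.

End Norm.

Lemma star_hom_le (A B : cstarAlgType R) (f : A -> B) : star_hom f ->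
  forall x, `|f x| <= `|x|.
Proof.
move=> [fL fM fadj] x.
have f0 : f 0 = 0.
  have := fL 1 0 0; rewrite !scale1r !addr0 => /eqP.
  by rewrite -subr_eq0 opprD addrA subrr sub0r oppr_eq0 => /eqP.
have fD a b : f (a + b) = f a + f b by rewrite -[a]scale1r fL !scale1r.
have fZ k a : f (k *: a) = k *: f a by rewrite -[k *: a]addr0 fL f0 addr0.
have fsa h : adj h = h -> `|h| < 1 -> `|f h| <= 1.
  move=> hsa /(sa_sqrt hsa)[t [tsa th tE]]; apply: (@sa_le1 _ _ (f t)).
  - by rewrite -fadj hsa.
  - by rewrite -fadj tsa.
  - by rewrite -!fM th.
  - by rewrite -!fM -!fD tE.
rewrite real_leNgt ?normr_real//; apply/negP => xf.
have f2 : `|x| ^+ 2 < `|f x| ^+ 2 by rewrite ltrXn2r.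
pose c : R[i] := 2 / (`|x| ^+ 2 + `|f x| ^+ 2).
have d0 : 0 < `|x| ^+ 2 + `|f x| ^+ 2.
  by rewrite ltr_wpDl ?exprn_ge0// (le_lt_trans _ f2)// exprn_ge0.
have c0 : 0 < c by rewrite divr_gt0.
have : `|f (c *: (adj x ** x))| <= 1.
  apply: fsa.
    by rewrite adjZ adjM adjK geC0_conj// ltW.
  rewrite normrZ norm_adjM gtr0_norm// /c mulrAC ltr_pdivrMr// mul1r.
  by rewrite mulr_natl mulr2n ltrD2l.
rewrite fZ normrZ gtr0_norm// fM fadj norm_adjM /c mulrAC ler_pdivrMr// mul1r.
by rewrite mulr_natl mulr2n lerD2r lt_geF.
Qed.

End Contractive.

(* Automatically isometric, by [star_hom_le] applied to it and to its inverse. *)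
Record starAut (R : realType) (A : starAlgType R) := StarAut {
  aut_fun :> A -> A;
  aut_inv : A -> A;
  aut_hom : star_hom aut_fun;
  autK : cancel aut_fun aut_inv;
  autVK : cancel aut_inv aut_fun
}.

Record cstarSub (R : realType) (A : cstarAlgType R) := CStarSub {
  cstarSub_sub :> starSub A;
  cstarSub_closed : closed (cstarSub_sub : set A)
}.

Section FullSub.
Variables (R : realType) (A : cstarAlgType R).

Definition starSubT : starSub A :=
  @StarSub R A setT I (fun _ _ _ _ => I) (fun _ _ _ => I) (fun _ _ _ _ => I)
    (fun _ _ => I).

Definition cstarSubT : cstarSub A := @CStarSub R A starSubT closedT.

Definition separable (D : set A) :=
  exists S : set A, [/\ countable S, S `<=` D & D `<=` closure S].

End FullSub.

Section ProperlyOuter.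
Variables (R : realType) (A : cstarAlgType R) (alpha : starAut A).

Definition aut_pow (n : int) : A -> A :=
  match n with
  | Posz k => iter k alpha
  | Negz k => iter k.+1 (aut_inv alpha)
  end.

Definition zpartial (V : zmodType) (u : int -> V) (N : nat) : V :=
  \sum_(k < N.*2.+1) u (k%:Z - N%:Z).

Definition ell1 (f : int -> R[i]) :=
  summable [set: int] (fun n => (complex.Re `|f n|)%:E).

(* [arveson_sp E] is the Arveson spectrum of the restriction to [E] of [alpha],
   seen as an action of the integers: the zeros common to the Fourier transforms
   of those [f] in l1(Z) for which the operator sum_n f(n) alpha^n kills [E].
   All series converge absolutely, so that symmetric partial sums suffice. *)
Definition arveson_sp (E : set A) : set R[i] :=
  [set z | `|z| = 1 /\ forall f : int -> R[i], ell1 f ->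
    (forall a, E a -> zpartial (fun n => f n *: aut_pow n a) @ \oo --> (0 : A)) ->
    zpartial (fun n => f n * z ^ n : R[i]^o) @ \oo --> (0 : R[i]^o)].

(* Below, the set [D] plays the role of the ambient C*-algebra: positivity,
   hereditary subalgebras, ideals and essential ideals are those of [D]. *)
Definition cstar_pos (D : set A) (b : A) := exists2 c, D c & b = adj c ** c.

Definition hereditary (D E : set A) :=
  E `<=` D /\ forall b e, D b -> E e -> cstar_pos D b -> cstar_pos D (e - b) -> E b.

Definition closed_ideal (D J : set A) :=
  [/\ closed J, J `<=` D, J 0, forall x y, J x -> J y -> J (x + y)
    & (forall (k : R[i]) x, J x -> J (k *: x)) /\
      forall d x, D d -> J x -> J (d ** x) /\ J (x ** d)].

Definition ideal_gen (D E : set A) : set A := smallest (closed_ideal D) E.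

Definition essential_ideal (D I : set A) := closed_ideal D I /\
  forall J, closed_ideal D J -> J <> [set 0] -> I `&` J <> [set 0].

(* For an [alpha]-invariant C*-subalgebra [D], the sets of hereditary subalgebras
   of [D] attached to the restriction of [alpha] to [D]. *)
Definition inv_hered (D : cstarSub A) : set (cstarSub A) :=
  [set E : cstarSub A |
    [/\ hereditary D E, (E : set A) <> [set 0] & alpha @` E = E]].

Definition inv_heredB (D : cstarSub A) : set (cstarSub A) :=
  [set E : cstarSub A | inv_hered D E /\ essential_ideal D (ideal_gen D E)].

Definition borchers_sp (D : cstarSub A) : set R[i] :=
  \bigcap_(E in inv_heredB D) arveson_sp (E : cstarSub A).

Definition properly_outer :=
  forall D, inv_hered (cstarSubT A) D -> borchers_sp D <> [set 1].

End ProperlyOuter.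

Section OrderZero.
Variables (R : realType) (B C : starAlgType R).

Definition orthogonal_elts (D : starAlgType R) (a b : D) :=
  [/\ a ** b = 0, b ** a = 0, adj a ** b = 0 & adj b ** a = 0].

(* Positivity of [x] in the matrix algebra over [D], i.e. [x = y^* y]. *)
Definition mx_pos (D : starAlgType R) n (x : 'M[D]_n) :=
  exists y : 'M[D]_n, forall i j, x i j = \sum_k adj (y k i) ** y k j.

Definition completely_positive (phi : B -> C) :=
  (forall (k : R[i]) x y, phi (k *: x + y) = k *: phi x + phi y) /\
  forall n (x : 'M[B]_n), mx_pos x -> mx_pos (map_mx phi x).

(* The norms are passed as functions because the target of interest is a quotient
   that is only equipped here with its *-algebra structure and quotient norm. *)
Definition ccp_order_zero (normB : B -> R) (normC : C -> R) (phi : B -> C) :=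
  [/\ completely_positive phi,
      forall x, normC (phi x) <= normB x
    & forall a b, orthogonal_elts a b -> orthogonal_elts (phi a) (phi b)].

End OrderZero.

Definition is_unit (R : realType) (B : starAlgType R) (e : B) :=
  forall x, e ** x = x /\ x ** e = x.

Definition sup_norm (R : realType) (V : normedModType R[i]) (T : Type)
  (f : T -> V) : R := sup (range (fun t => complex.Re `|f t|)).

Definition quot_norm (R : realType) (B : starAlgType R) (normB : B -> R)
  (J : starIdeal B) (q : quotAlg J) : R :=
  inf [set normB b | b in [set b | qpi J b = q]].

Section CentralSequence.
Variables (R : realType) (A : cstarAlgType R).

Definition bounded_seq (x : nat -> A) := exists M : R[i], forall n, `|x n| <= M.

Lemma bounded_seq0 : bounded_seq 0.
Proof. by exists 0 => n; rewrite normr0. Qed.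
Lemma bounded_seqD x y : bounded_seq x -> bounded_seq y -> bounded_seq (x + y).
Proof.
move=> [M xM] [N yN]; exists (M + N) => n.
by rewrite (le_trans (ler_normD _ _))// lerD.
Qed.
Lemma bounded_seqZ (k : R[i]) x : bounded_seq x -> bounded_seq (k *: x).
Proof. by move=> [M xM]; exists (`|k| * M) => n; rewrite normrZ ler_wpM2l. Qed.
Lemma bounded_seqM x y : bounded_seq x -> bounded_seq y -> bounded_seq (x ** y).
Proof.
move=> [M xM] [N yN]; exists (M * N) => n.
by rewrite (le_trans (norm_amul _ _))// ler_pM.
Qed.
Lemma bounded_seq_adj x : bounded_seq x -> bounded_seq (adj x).
Proof. by move=> [M xM]; exists M => n; rewrite norm_adj. Qed.

Definition linf_sub : starSub (nat -> A) :=
  StarSub bounded_seq0 bounded_seqD bounded_seqZ bounded_seqM bounded_seq_adj.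

Definition linf := subAlg linf_sub.

Definition null_seq (x : linf) := val x @ \oo --> (0 : A).

Lemma null_seqP (x : linf) : null_seq x <->
  forall e : R[i], 0 < e -> \forall n \near \oo, `|val x n| < e.
Proof. exact: cvgr0Pnorm_lt. Qed.

Lemma null_seq_le (x y : linf) (M : R[i]) :
  (forall n, `|val y n| <= M * `|val x n|) -> null_seq x -> null_seq y.
Proof.
move=> yx; apply: (@ctrl_cvg R _ _ (`|M| + 1)) => [|n].
  by rewrite ltr_wpDl.
rewrite !subr0 (le_trans (yx n))//.
have [M0|M0] := boolP (0 <= M).
  by rewrite (ger0_norm M0) ler_wpM2r// lerDl.
have [->|x0] := eqVneq (val x n) 0; first by rewrite normr0 !mulr0.
have xp : 0 < `|val x n| by rewrite normr_gt0.
by case/negP: M0; rewrite -(pmulr_lge0 _ xp) (le_trans _ (yx n)).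
Qed.

Lemma null_seq0 : null_seq 0. Proof. exact: cvg_cst. Qed.
Lemma null_seqD x y : null_seq x -> null_seq y -> null_seq (x + y).
Proof. by move=> x0 y0; rewrite /null_seq -(addr0 0); exact: cvgD. Qed.
Lemma null_seqZ (k : R[i]) x : null_seq x -> null_seq (k *: x).
Proof. by apply: (@null_seq_le _ _ `|k|) => n; rewrite normrZ. Qed.
Lemma null_seqMl x y : null_seq y -> null_seq (x ** y).
Proof.
have [M xM] := subAlg_in x.
apply: (@null_seq_le _ _ M) => n.
by rewrite (le_trans (norm_amul _ _))// ler_wpM2r.
Qed.
Lemma null_seqMr x y : null_seq x -> null_seq (x ** y).
Proof.
have [M yM] := subAlg_in y.
apply: (@null_seq_le _ _ M) => n.
by rewrite (le_trans (norm_amul _ _))// mulrC ler_wpM2r.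
Qed.
Lemma null_seq_adj x : null_seq x -> null_seq (adj x).
Proof. by apply: (@null_seq_le _ _ 1) => n; rewrite norm_adj mul1r. Qed.

Definition c0_ideal : starIdeal linf :=
  StarIdeal null_seq0 null_seqD null_seqZ null_seqMl null_seqMr null_seq_adj.

Definition Ainf := quotAlg c0_ideal.

Definition linf_norm (x : linf) : R := sup_norm (val x).
Definition Ainf_norm : Ainf -> R := quot_norm linf_norm (J := c0_ideal).

Lemma bounded_seq_cst (a : A) : bounded_seq (fun=> a).
Proof. by exists `|a|. Qed.

Definition cst_linf (a : A) : linf := mkSub (S := linf_sub) (bounded_seq_cst a).
Definition cst_Ainf (a : A) : Ainf := qpi c0_ideal (cst_linf a).

Lemma cst_Ainf_adj a : cst_Ainf (adj a) = adj (cst_Ainf a).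
Proof.
rewrite /cst_Ainf -qpi_adj; congr (qpi _ _).
exact/val_inj.
Qed.

Section Cent.
Variable D : starSub A.

Definition commuting (x : Ainf) :=
  forall d, D d -> x ** cst_Ainf d = cst_Ainf d ** x.

Lemma commuting0 : commuting 0.
Proof. by move=> d _; rewrite amul0r amulr0. Qed.
Lemma commutingD x y : commuting x -> commuting y -> commuting (x + y).
Proof. by move=> xD yD d Dd; rewrite amulDl amulDr xD// yD. Qed.
Lemma commutingZ (k : R[i]) x : commuting x -> commuting (k *: x).
Proof. by move=> xD d Dd; rewrite amulZl amulZr xD. Qed.
Lemma commutingM x y : commuting x -> commuting y -> commuting (x ** y).
Proof. by move=> xD yD d Dd; rewrite -amulA yD// !amulA xD. Qed.
Lemma commuting_adj x : commuting x -> commuting (adj x).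
Proof.
move=> xD d Dd; rewrite -(adjK d) cst_Ainf_adj -!adjM xD//.
exact: starSub_adj.
Qed.

Definition comm_sub : starSub Ainf :=
  StarSub commuting0 commutingD commutingZ commutingM commuting_adj.

Definition comm_alg := subAlg comm_sub.

Definition annihilating (x : comm_alg) :=
  forall d, D d -> val x ** cst_Ainf d = 0 /\ cst_Ainf d ** val x = 0.

Lemma annihilating0 : annihilating 0.
Proof. by move=> d _; rewrite amul0r amulr0. Qed.
Lemma annihilatingD x y : annihilating x -> annihilating y -> annihilating (x + y).
Proof.
move=> xD yD d Dd; have [x1 x2] := xD d Dd; have [y1 y2] := yD d Dd.
by rewrite raddfD/= amulDl amulDr x1 x2 y1 y2 addr0.
Qed.
Lemma annihilatingZ (k : R[i]) x : annihilating x -> annihilating (k *: x).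
Proof.
move=> xD d Dd; have [x1 x2] := xD d Dd.
by rewrite linearZ/= amulZl amulZr x1 x2 scaler0.
Qed.
Lemma annihilatingMl x y : annihilating y -> annihilating (x ** y).
Proof.
move=> yD d Dd; have [y1 y2] := yD d Dd.
rewrite val_amul -amulA y1 amulr0 amulA -(subAlg_in x d Dd).
by rewrite -amulA y2 amulr0.
Qed.
Lemma annihilatingMr x y : annihilating x -> annihilating (x ** y).
Proof.
move=> xD d Dd; have [x1 x2] := xD d Dd.
rewrite val_amul amulA x2 amul0r -amulA (subAlg_in y d Dd).
by rewrite amulA x1 amul0r.
Qed.
Lemma annihilating_adj x : annihilating x -> annihilating (adj x).
Proof.
move=> xD d Dd; have [x1 x2] := xD _ (starSub_adj Dd).
by rewrite val_adj -(adjK d) cst_Ainf_adj -!adjM x1 x2 adj0.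
Qed.

Definition ann_ideal : starIdeal comm_alg :=
  StarIdeal annihilating0 annihilatingD annihilatingZ annihilatingMl
    annihilatingMr annihilating_adj.

Definition central_alg := quotAlg ann_ideal.

Definition comm_norm (x : comm_alg) : R := Ainf_norm (val x).
Definition central_norm : central_alg -> R :=
  quot_norm comm_norm (J := ann_ideal).

End Cent.

Section Induced.
Variable alpha : starAut A.

Lemma bounded_seq_aut (x : linf) : bounded_seq (fun n => alpha (val x n)).
Proof.
have [M xM] := subAlg_in x; exists M => n.
by rewrite (le_trans _ (xM n))// star_hom_le//; exact: aut_hom.
Qed.

Definition linf_aut (x : linf) : linf := mkSub (S := linf_sub) (bounded_seq_aut x).

(* Induced maps on the quotients are computed on representatives; [Ainf_autE] and
   [central_autE] show that the choice is irrelevant. *)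
Definition Ainf_aut (q : Ainf) : Ainf := qpi c0_ideal (linf_aut (qrepr q)).

Lemma autB (a b : A) : alpha (a - b) = alpha a - alpha b.
Proof.
by have [aL _ _] := aut_hom alpha; rewrite addrC -scaleN1r aL scaleN1r addrC.
Qed.

Lemma Ainf_autE x : Ainf_aut (qpi c0_ideal x) = qpi c0_ideal (linf_aut x).
Proof.
apply/qpi_eq; have := qrepr_sub c0_ideal x.
apply: (@null_seq_le _ _ 1) => n; rewrite mul1r.
have := star_hom_le (aut_hom alpha) (val (qrepr (qpi c0_ideal x)) n - val x n).
by rewrite autB.
Qed.

Lemma Ainf_autM p q : Ainf_aut (p ** q) = Ainf_aut p ** Ainf_aut q.
Proof.
rewrite -[p]qreprK -[q]qreprK -qpiM !Ainf_autE -qpiM; congr (qpi _ _).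
apply/val_inj/funext => n /=.
by have [_ aM _] := aut_hom alpha; exact: aM.
Qed.

Lemma Ainf_autB p q : Ainf_aut (p - q) = Ainf_aut p - Ainf_aut q.
Proof.
rewrite -[p]qreprK -[q]qreprK -qpiB !Ainf_autE -qpiB; congr (qpi _ _).
by apply/val_inj/funext => n; exact: autB.
Qed.

Lemma Ainf_aut0 : Ainf_aut 0 = 0.
Proof. by have := Ainf_autB 0 0; rewrite !subrr. Qed.

Lemma Ainf_aut_cst a : Ainf_aut (cst_Ainf a) = cst_Ainf (alpha a).
Proof. by rewrite Ainf_autE; congr (qpi _ _); exact/val_inj. Qed.

Variables (D : starSub A) (invD : alpha @` D = D).

Lemma commuting_aut (x : comm_alg D) : commuting D (Ainf_aut (val x)).
Proof.
move=> d; rewrite -invD => -[c Dc <-].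
by rewrite -Ainf_aut_cst -!Ainf_autM (subAlg_in x c Dc).
Qed.

Definition comm_aut (x : comm_alg D) : comm_alg D :=
  mkSub (S := comm_sub D) (commuting_aut x).

Definition central_aut (q : central_alg D) : central_alg D :=
  qpi (ann_ideal D) (comm_aut (qrepr q)).

Lemma central_autE x :
  central_aut (qpi (ann_ideal D) x) = qpi (ann_ideal D) (comm_aut x).
Proof.
apply/qpi_eq => d; rewrite -invD => -[c Dc <-]; rewrite -Ainf_aut_cst.
set y := qrepr _; rewrite raddfB/= -Ainf_autB -!Ainf_autM.
have yx : annihilating (y - x) := qrepr_sub (ann_ideal D) x.
by have [] := yx c Dc; rewrite raddfB/= => -> ->; rewrite Ainf_aut0.
Qed.

End Induced.

End CentralSequence.

Record subgroup (G : groupType) := Subgroup {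
  subgroup_set :> G -> Prop;
  subgroup1 : subgroup_set 1%g;
  subgroupM : forall x y, subgroup_set x -> subgroup_set y -> subgroup_set (x * y)%g;
  subgroupV : forall x, subgroup_set x -> subgroup_set x^-1%g
}.

Section Groups.
Variable G : groupType.

Definition left_coset (H : set G) (g : G) : set G := [set (g * h)%g | h in H].

Record cosets (H : subgroup G) := Coset {
  coset_set :> G -> Prop;
  coset_ex : exists g, coset_set = left_coset H g
}.

Lemma translate_coset (H : subgroup G) (t : G) (c : cosets H) :
  exists g, left_coset c t = left_coset H g.
Proof.
have [g ->] := coset_ex c; exists (t * g)%g.
apply/seteqP; split=> [_ [_ [h Hh <-] <-]|_ [h Hh <-]] /=.
  by exists h => //; rewrite mulgA.
by exists (g * h)%g; [exists h|rewrite mulgA].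
Qed.

Definition coset_translate (H : subgroup G) (t : G) (c : cosets H) : cosets H :=
  Coset (translate_coset t c).

Definition finite_index (H : subgroup G) := finite_set [set: cosets H].

Definition cyclic_subset (g : G) : set G :=
  [set x | exists n : nat, x = (g ^+ n)%g \/ x = (g ^- n)%g].

Definition normal_subgroup (H : subgroup G) :=
  forall g h, H h -> H (g * h * g^-1)%g.

Definition residually_finite := forall g : G, g <> 1%g ->
  exists H : subgroup G, [/\ normal_subgroup H, finite_index H & ~ H g].

Definition virtual_retract (H : set G) :=
  exists (K : subgroup G) (rho : G -> G),
    [/\ finite_index K, H `<=` K,
        forall x y, K x -> K y -> rho (x * y)%g = (rho x * rho y)%g,
        forall x, K x -> H (rho x)
      & forall x, H x -> rho x = x].

Definition VRC := forall g : G, virtual_retract (cyclic_subset g).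

Definition bounded_fun (R : realType) (f : G -> R) :=
  exists M : R, forall x, `|f x| <= M.

(* Existence of a left-invariant mean on the bounded real functions on [G]. *)
Definition amenable (R : realType) := exists m : (G -> R) -> R,
  [/\ forall (k : R) f g, bounded_fun f -> bounded_fun g ->
        m (fun x => k * f x + g x) = k * m f + m g,
      forall f, bounded_fun f -> (forall x, 0 <= f x) -> 0 <= m f,
      m (fun=> 1) = 1
    & forall t f, bounded_fun f -> m (fun x => f (t^-1 * x)%g) = m f].

End Groups.

Section Rokhlin.
Variables (R : realType) (A : cstarAlgType R) (G : groupType).

(* Homomorphisms from [G] to the group of automorphisms of [A]. *)
Definition is_action (alpha : G -> starAut A) :=
  forall g h a, alpha (g * h)%g a = alpha g (alpha h a).

Definition properly_outer_action (alpha : G -> starAut A) :=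
  forall g, g <> 1%g -> properly_outer (alpha g).

Definition C_cosets (H : subgroup G) := cosets H -> R[i]^o.

Definition coset_act (H : subgroup G) (t : G) (f : C_cosets H) : C_cosets H :=
  fun c => f (coset_translate t^-1%g c).

Definition rokhlin_towers (alpha : G -> starAut A) (H : subgroup G) (d : nat) :=
  forall (D : cstarSub A) (invD : forall t, alpha t @` D = D), separable D ->
  exists phi : 'I_d.+1 -> C_cosets H -> central_alg D,
    [/\ forall l, ccp_order_zero (@sup_norm R R[i]^o (cosets H))
          (@central_norm R A D) (phi l),
        forall l t f, phi l (coset_act t f) = central_aut (invD t) (phi l f)
      & is_unit (\sum_l phi l (fun=> 1))].

(* The infimum is over a set of natural numbers, hence attained if nonempty; it is
   [+oo] otherwise. *)
Definition dim_rok_at (alpha : G -> starAut A) (H : subgroup G) : \bar R :=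
  ereal_inf [set d%:R%:E | d in rokhlin_towers alpha H].

Definition dim_rok (alpha : G -> starAut A) : \bar R :=
  ereal_sup [set dim_rok_at alpha H | H in [set H : subgroup G | finite_index H]].

End Rokhlin.

(* Main.v *)
(* Let g <> 1, let H be a normal subgroup of finite index not containing g, let
   m > 1 be the order of g modulo H and omega <> 1 a complex number with
   omega^m = 1. For a coset c and a Rokhlin tower phi, the element
   q = phi (sum_(j < m) omega^-j delta_(g^j c)) of F(A, A) satisfies
   g^k q = omega^k q, and phi(delta_c) q = phi(delta_c)^2 since phi has order zero.
   Let f in l1(Z) be such that sum_k f(k) g^k vanishes on E, where E is hereditary
   in D and D is hereditary in A. If (y_n) lifts q, then a1 a2 y_n a3 a4 is in E
   for a1, ..., a4 in E; applying sum_k f(k) g^k to it and letting n go to infinity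
   gives q w = 0, with w = sum_k f(k) omega^k g^k(a1 a2 a3 a4). Hence
   phi(delta_c) w = 0 for all c and all towers, so that w = 0. Therefore
   sum_k f(k) omega^k g^k vanishes on E as well: the Arveson spectrum of g on E is
   invariant under multiplication by omega, and 1 cannot be the only common point
   of such spectra. *)

From mathcomp Require Import all_boot all_order all_algebra.
From mathcomp Require Import all_classical all_reals all_analysis.
From mathcomp Require Import complex ring zify.
Require Import Defs.

Set Implicit Arguments.
Unset Strict Implicit.
Unset Printing Implicit Defensive.

Import Order.TTheory GRing.Theory Num.Theory.
Import numFieldNormedType.Exports.

Local Open Scope classical_set_scope.
Local Open Scope complex_scope.
Local Open Scope ring_scope.
Local Open Scope star_scope.


(** * Limits *)

Section NormedLimits.
Variables (R : realType) (V : normedModType R[i]).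
Implicit Types (u v : nat -> V) (a b : V).

Lemma cvg_lin (W : normedModType R[i]) (h : V -> W) (C : R[i]) u a :
  (forall x y, h (x - y) = h x - h y) -> (forall x, `|h x| <= C * `|x|) ->
  u @ \oo --> a -> (fun n => h (u n)) @ \oo --> h a.
Proof.
move=> hB hC; apply: (@ctrl_cvg _ _ _ (`|C| + 1)) => [|n].
  by rewrite ltr_wpDl.
rewrite -hB (le_trans (hC _))//.
(* The order of [R[i]] is partial: if [C] is not nonnegative, the bound can only hold at
   [u n - a = 0]. *)
have [C0|C0] := boolP (0 <= C).
  by rewrite (ger0_norm C0) ler_wpM2r// lerDl.
have [->|x0] := eqVneq (u n - a) 0; first by rewrite normr0 !mulr0.
case/negP: C0; have x1 : 0 < `|u n - a| by rewrite normr_gt0.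
by rewrite -(pmulr_lge0 _ x1) (le_trans _ (hC _)).
Qed.

Lemma cvg0_ex u : u @ \oo --> (0 : V) ->
  forall e : R[i], 0 < e -> exists n, forall m, (n <= m)%N -> `|u m| < e.
Proof. by move/cvgr0Pnorm_lt => u0 e /u0[n _ nP]; exists n. Qed.

Lemma cvg_eq u v a : (fun n => u n - v n) @ \oo --> (0 : V) -> v @ \oo --> a ->
  u @ \oo --> a.
Proof.
move=> uv va; have -> : u = (fun n => (u n - v n) + v n).
  by apply/funext => n; rewrite subrK.
by rewrite -[a]add0r; exact: cvgD.
Qed.

Lemma ge0_complexE (x : R[i]) : 0 <= x -> x = (complex.Re x)%:C.
Proof. by move=> x0; rewrite RRe_real// ger0_real. Qed.

(** The Archimedean property of [R], read on real parts. *)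
Lemma div_natr_lt (C e : R[i]) : 0 <= C -> 0 < e ->
  exists n, forall m, (n <= m)%N -> C / m.+1%:R < e.
Proof.
move=> C0 e0; set c := complex.Re C; set d := complex.Re e.
have eE : e = d%:C := ge0_complexE (ltW e0).
have d0 : 0 < d by rewrite -ltcR -eE.
have c0 : 0 <= c by rewrite -lecR -ge0_complexE.
have : 0 <= c / d by rewrite divr_ge0// ltW.
move=> /archi_boundP; set n := Num.bound _ => nP.
exists n => m nm; rewrite ltr_pdivrMr ?ltr0Sn// (ge0_complexE C0) eE.
rewrite -(rmorph_nat (real_complex R)) -rmorphM ltcR.
rewrite mulrC -ltr_pdivrMr// (lt_le_trans nP)// ler_nat.
exact: leq_trans nm (leqnSn _).
Qed.

Lemma pow2_ge (n : nat) : n.+1%:R <= 2 ^+ n :> R[i].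
Proof. by rewrite -natrX ler_nat ltn_expl. Qed.

Lemma half_pow_le n : 2^-1 ^+ n <= 1 / n.+1%:R :> R[i].
Proof.
have p0 : 0 < 2 ^+ n :> R[i] by rewrite exprn_gt0.
rewrite mul1r exprVn lef_pV2 ?posrE ?ltr0Sn//.
exact: pow2_ge.
Qed.

End NormedLimits.

Lemma cauchy_seq_cvg (R : realType) (V : completeNormedModType R[i])
    (u : nat -> V) :
  (forall e : R[i], 0 < e -> exists n, forall m, (n <= m)%N -> `|u m - u n| < e) ->
  exists a : V, u @ \oo --> a.
Proof.
move=> uc; suff : cauchy (u @ \oo) by move=> /cauchy_cvgP /cvg_ex.
apply: cauchy_exP => e /uc[n nP]; exists (u n), n => // m /= /nP.
by rewrite -ball_normE /= distrC.
Qed.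

Lemma geometric_cvg (R : realType) (V : completeNormedModType R[i])
    (u : nat -> V) :
  (forall n, `|u n.+1 - u n| <= 2^-1 ^+ n) -> exists a : V, u @ \oo --> a.
Proof.
move=> du.
(* The right-hand side is the geometric sum of the steps from [m] to [m + k]. *)
have tail m k : `|u (m + k)%N - u m| <= 2 * 2^-1 ^+ m - 2 * 2^-1 ^+ (m + k).
  elim: k => [|k ih]; first by rewrite addn0 !subrr normr0.
  rewrite addnS -(subrK (u (m + k)%N) (u _.+1)) -addrA.
  rewrite (le_trans (ler_normD _ _))// (le_trans (lerD (du _) ih))//.
  rewrite exprS mulrA divff// mul1r.
  by rewrite le_eqVlt; apply/orP; left; apply/eqP; ring.
apply: cauchy_seq_cvg => e e0.
have [n nP] := @div_natr_lt R 2 e (ler0n _ _) e0.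
exists n => m nm; rewrite -(subnKC nm) (le_lt_trans (tail _ _))//.
rewrite (@le_lt_trans _ _ (2 * 2^-1 ^+ n))//.
  by rewrite lerBlDr lerDl mulr_ge0// exprn_ge0// invr_ge0.
rewrite exprVn (le_lt_trans _ (nP n _))// ler_pM2l// lef_pV2 ?posrE ?exprn_gt0//.
exact: pow2_ge.
Qed.

(** * Square roots and local units in C*-algebras *)

Section CStarTheory.
Variables (R : realType) (A : cstarAlgType R).
Implicit Types (x y z k s t : A).

Lemma norm_le_amul x y : `|x| <= 1 -> `|x ** y| <= `|y|.
Proof.
by move=> x1; rewrite (le_trans (norm_amul _ _))// ler_piMl.
Qed.

Lemma cvg_amull x (u : nat -> A) y : u @ \oo --> y ->
  (fun n => x ** u n) @ \oo --> x ** y.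
Proof.
apply: (@cvg_lin _ _ _ (amul x) `|x|) => [a b|a]; first exact: amulBr.
exact: norm_amul.
Qed.

Lemma cvg_amulr x (u : nat -> A) y : u @ \oo --> y ->
  (fun n => u n ** x) @ \oo --> y ** x.
Proof.
apply: (@cvg_lin _ _ _ (amul^~ x) `|x|) => [a b|a]; first exact: amulBl.
by rewrite mulrC; exact: norm_amul.
Qed.

Lemma cvg_adj (u : nat -> A) y : u @ \oo --> y ->
  (fun n => adj (u n)) @ \oo --> adj y.
Proof.
apply: (@cvg_lin _ _ _ (@adj R A) 1) => [a b|a]; first exact: adjB.
by rewrite mul1r norm_adj.
Qed.

Lemma cstarSub_cvg (D : cstarSub A) (u : nat -> A) y :
  (forall n, D (u n)) -> u @ \oo --> y -> D y.
Proof.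
by move=> Du; apply: closed_cvg => //; [exact: cstarSub_closed|exact: nearW].
Qed.

Lemma cvg_uniq (u v : nat -> A) x y :
  u =1 v -> u @ \oo --> x -> v @ \oo --> y -> x = y.
Proof. by move=> /funext ->; exact: cvg_unique. Qed.

Lemma adj_half x : adj (2^-1 *: x) = 2^-1 *: adj x.
Proof. by rewrite adjZ geC0_conj// invr_ge0. Qed.

Lemma dbl_scale x : 2 *: x = x + x.
Proof. by rewrite scaler_nat mulr2n. Qed.

(* The iteration for [1 - t = sqrt (1 - k)]. *)
Lemma sqrt_one_sub (D : cstarSub A) k : D k -> adj k = k -> `|k| <= 2^-1 ->
  exists t, [/\ D t, adj t = t, forall y, y ** k = k ** y -> y ** t = t ** y
    & t + t = k + t ** t].
Proof.
move=> Dk ksa k2.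
pose s := fix s n := if n is m.+1 then 2^-1 *: (k + s m ** s m) else 0 : A.
have half0 : 0 <= 2^-1 :> R[i] by rewrite invr_ge0.
have half2 (a b : A) (c : R[i]) : `|a| <= c -> `|b| <= c ->
    `|2^-1 *: (a + b)| <= c.
  move=> ac bc; rewrite normrZ ger0_norm// ler_pdivrMl// mulr_natl mulr2n.
  by rewrite (le_trans (ler_normD _ _))// lerD.
have half1 : 2^-1 <= 1 :> R[i] by rewrite invf_le1// ler1n.
(* The ball of radius 1/2 is stable under the iteration, which contracts distances there by 1/2;
   hence the geometric convergence. *)
have sle n : `|s n| <= 2^-1.
  elim: n => [|n ih] /=; first by rewrite normr0.
  apply: half2 => //; rewrite (le_trans (norm_le_amul _ _))//.
  exact: le_trans ih half1.
have [t st] : exists t : A, s @ \oo --> t.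
  apply: geometric_cvg; elim=> [|n ih].
    by rewrite subr0 expr0 (le_trans (sle _)).
  have -> : s n.+2 - s n.+1 =
      2^-1 *: (s n.+1 ** (s n.+1 - s n) + (s n.+1 - s n) ** s n).
    rewrite -[LHS]/(2^-1 *: (k + s n.+1 ** s n.+1)
      - 2^-1 *: (k + s n ** s n)) -scalerBr amulBr amulBl.
    by congr (_ *: _); rewrite opprD addrACA subrr add0r addrA subrK.
  by apply: half2; rewrite (le_trans (norm_amul _ _))//;
    [rewrite exprS|rewrite exprSr]; exact: ler_pM.
(* Membership, self-adjointness and commutation hold for each [s n], a polynomial in [k] without
   constant term, and pass to the limit; the equation is the limit of the recursion. *)
exists t; split.
- apply: (cstarSub_cvg _ st); elim=> [|n ih] /=; first exact: starSub0.
  by apply: starSubZ; apply: starSubD => //; exact: starSubM.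
- apply: (@cvg_uniq (adj \o s) s) => //; last exact: cvg_adj.
  elim=> [|n /= ih] /=; first exact: adj0.
  by rewrite adj_half adjD adjM ih ksa.
- move=> y yk.
  apply: (@cvg_uniq (fun n => y ** s n) (fun n => s n ** y)); first last.
  + exact: cvg_amulr.
  + exact: cvg_amull.
  elim=> [|n ih] /=; first by rewrite amul0r amulr0.
  by rewrite amulZr amulZl amulDl amulDr yk amulA ih -!amulA ih.
- have st1 : (fun n => s n.+1) @ \oo --> t.
    by move/(cvg_comp _ _ (cvg_addnl 1)): st.
  apply: (@cvg_uniq (fun n => s n.+1 + s n.+1) (fun n => k + s n ** s n)).
  + by move=> n /=; rewrite -dbl_scale scalerA divff ?scale1r.
  + exact: cvgD.
  + apply: cvgD; first exact: cvg_cst.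
    apply: (@cvg_eq _ _ _ (fun n => s n ** t)); last exact: cvg_amulr.
    have st0 : (fun n => s n - t) @ \oo --> (0 : A).
      by rewrite -(subrr t); apply: cvgB => //; exact: cvg_cst.
    apply: (@ctrl_cvg _ _ _ 1 _ _ _ _ ltr01 _ st0) => n.
    rewrite !subr0 mul1r -amulBr norm_le_amul//.
    exact: le_trans (sle n) half1.
Qed.

(* The elements [s + i (1 - t)] and [s - i (1 - t)] are unitary multipliers. *)
Lemma sin_cos_le s t x : adj s = s -> adj t = t -> s ** t = t ** s ->
  t + t = s ** s + t ** t -> `|s ** x| <= `|x| /\ `|x - t ** x| <= `|x|.
Proof.
move=> ssa tsa st tE.
pose p := s ** x; pose q := x - t ** x.
(* [pq] cancels the cross terms in the square of [p + z q] for [z = i] or [z = -i]; [ppqq] expresses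
   [s^2 + (1 - t)^2 = 1]. *)
have pq : adj p ** q = adj q ** p.
  rewrite /p /q adjB !adjM ssa tsa amulBl amulBr -!amulA.
  by rewrite (amulA s t) st -amulA.
have ppqq : adj p ** p + adj q ** q = adj x ** x.
  have sE : s ** s = t + t - t ** t by rewrite tE addrK.
  rewrite /p /q adjB !adjM ssa tsa !amulBl !amulBr -!amulA.
  rewrite (amulA s s) sE amulBl amulDl amulBr amulDr -!amulA.
  set X := adj x ** (t ** x); set Y := adj x ** (t ** (t ** x)).
  set Z := adj x ** x.
  by rewrite -(addrA Z) -opprD (addrA X) [LHS]addrC subrK.
have iso (z : R[i]) : z^* = - z -> z ^+ 2 = -1 -> `|p + z *: q| = `|x|.
  move=> zc z2; apply/eqP; rewrite -(@eqrXn2 _ 2)// -!norm_adjM; apply/eqP.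
  congr (`| _ |).
  rewrite adjD adjZ zc amulDl !amulDr !amulZl !amulZr scalerA pq.
  rewrite mulNr -expr2 z2 opprK scale1r scaleNr addrA.
  by rewrite -(addrA _ (z *: _)) subrr addr0.
have iE : ('i : R[i])^* = - 'i by exact: conjCi.
have i2 : ('i : R[i]) ^+ 2 = -1 by exact: sqrCi.
have i_iso : `|p + 'i *: q| = `|x| by exact: iso.
have ni_iso : `|p - 'i *: q| = `|x|.
  by rewrite -scaleNr iso ?sqrrN//; exact: etrans (rmorphN _ _) (congr1 _ iE).
(* [2 p] and [2 i q] are the sum and the difference of [p + i q] and [p - i q], both of norm
   [|x|]. *)
have dbl (y : A) : `|y + y| <= `|x| + `|x| -> `|y| <= `|x|.
  by rewrite -dbl_scale normrZ normr_nat -mulr2n -[leRHS]mulr_natl ler_pM2l.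
rewrite -/p -/q; clear iso ppqq pq; clearbody p q.
split; apply: dbl; rewrite -{1}i_iso -ni_iso.
  have -> : p + p = (p + 'i *: q) + (p - 'i *: q).
    by rewrite addrACA subrr addr0.
  exact: ler_normD.
rewrite (le_trans _ (ler_normB _ _))// opprB.
rewrite [leRHS](_ : _ = `|'i *: (q + q)|); last first.
  by congr (`| _ |); rewrite scalerDr [p + _]addrC addrACA subrr addr0.
by rewrite normrZ normCi mul1r.
Qed.

End CStarTheory.

(** * Local units by repeated angle doubling *)

Section LocalUnits.
Variables (R : realType) (A : cstarAlgType R).
Implicit Types (x y z s t b : A).

(** This is [1 - (s + t - s t) = (1 - s)(1 - t)] without a unit; it lets contractions of the form
    [1 - z] be composed. *)
Lemma one_sub_mul s t y :
  y - (s + t - s ** t) ** y = (y - t ** y) - s ** (y - t ** y).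
Proof.
rewrite !amulBl amulDl amulBr -amulA !opprD !opprK !addrA.
by rewrite (addrAC y).
Qed.

(* With [s = sin a] and [t = 1 - cos a], the pair
   [(2 (s - s t), 2 s^2)] corresponds to the angle [2 a]. *)
Lemma double_angle s t : s ** t = t ** s -> t + t = s ** s + t ** t ->
  let s' := 2 *: (s - s ** t) in let t' := 2 *: (s ** s) in
  t' + t' = s' ** s' + t' ** t'.
Proof.
move=> st tE s' t'; rewrite /s' /t'; set q := s ** s.
have qE : q = t + t - t ** t by rewrite tE addrK.
(* [(1 - t)^2 = 1 - q], so the square of [s (1 - t)] is [q (1 - q)]. *)
have sst : (s - s ** t) ** (s - s ** t) = q - q ** q.
  rewrite [in X in _ = _ - _ ** X]qE amulBr !amulBl amulBr amulDr.
  have -> : s ** t ** s = q ** t by rewrite -amulA -st amulA.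
  have -> : s ** (s ** t) = q ** t by rewrite amulA.
  have -> : s ** t ** (s ** t) = q ** (t ** t).
    by rewrite -amulA (amulA t) -st !amulA.
  by rewrite !opprD !opprK !addrA.
rewrite !amulZl !amulZr !scalerA sst -(scalerDr _ (q - _)) subrK.
by rewrite -scalerDl; congr (_ *: _); rewrite -mulr2n mulr_natl.
Qed.

Section DoublingSteps.
Variables (D : cstarSub A) (b t0 : A).

(* [s = sin (2^(n+1) a)] and [1 - t = cos (2^(n+1) a)], where [b = sin a] and
   [1 - t0 = cos a]; the last condition is the identity
   [2^(n+1) sin a cos a prod_(j <= n) cos (2^j a) = cos a sin (2^(n+1) a)]. *)
Let invariant n := exists z t s,
  [/\ [/\ D z, D t, adj s = s, adj t = t & adj z = z],
      [/\ s ** t = t ** s, s ** t0 = t0 ** s, t ** t0 = t0 ** t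
        & z ** t = t ** z],
      [/\ z ** b = b ** z, t ** b = b ** t & t + t = s ** s + t ** t],
      forall x, `|x - z ** x| <= `|x|
    & 2 ^+ n.+1 *: (b - z ** b) = s - t0 ** s].

Let double n : invariant n -> invariant n.+1.
Proof.
move=> [z [t [s [[Dz Dt ssa tsa zsa] [st st0 tt0 zt] [zb tb tE] zle zE]]]].
(* [s] itself is not known to lie in [D], but [s^2 = 2 t - t^2] does. *)
have ssE : 2 *: (s ** s) = 2 *: (t + t - t ** t) by rewrite tE addrK.
have adj2 x : adj (2 *: x) = 2 *: adj x by rewrite adjZ conjC_nat.
(* The angle doubles, and [1 - z] gains the factor [1 - t = cos (2^(n+1) a)]. *)
exists (z + t - z ** t), (2 *: (s ** s)), (2 *: (s - s ** t)); split.
- split.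
  + rewrite -scaleN1r; apply: starSubD; first exact: starSubD.
    by apply: starSubZ; exact: starSubM.
  + rewrite ssE -scaleN1r; apply: starSubZ; apply: starSubD.
      exact: starSubD.
    by apply: starSubZ; exact: starSubM.
  + by rewrite adj2 adjB adjM ssa tsa st.
  + by rewrite adj2 adjM ssa.
  + by rewrite adjB adjD adjM zsa tsa zt.
- split.
  + rewrite !amulZl !amulZr; do 2!congr (_ *: _); rewrite amulBl amulBr.
    have tss : t ** (s ** s) = s ** s ** t by rewrite amulA -st -!amulA st.
    by congr (_ - _); rewrite -amulA // tss !amulA.
  + rewrite amulZl amulZr amulBl amulBr st0 -amulA tt0.
    by congr (_ *: (_ - _)); rewrite !amulA st0.
  + by rewrite amulZl amulZr -amulA st0 !amulA st0.
  + rewrite ssE amulZr amulZl; congr (_ *: _).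
    have ct : (z + t - z ** t) ** t = t ** (z + t - z ** t).
      by rewrite amulBl amulBr amulDl amulDr zt -amulA zt.
    move: (z + t - _) ct => x ct.
    by rewrite amulBr amulDr amulBl amulDl !amulA ct -!amulA ct.
- split.
  + rewrite !amulBl !amulBr !amulDl !amulDr zb tb; congr (_ - _).
    by rewrite -amulA tb !amulA zb.
  + rewrite ssE amulZr amulZl; congr (_ *: _).
    rewrite !amulBl !amulBr !amulDl !amulDr tb; congr (_ - _).
    by rewrite -amulA tb !amulA tb.
  + exact: double_angle.
- move=> x; rewrite one_sub_mul; apply: le_trans (zle _) _.
  by have [] := sin_cos_le x ssa tsa st tE.
- have -> : b - (z + t - z ** t) ** b = (b - z ** b) - t ** (b - z ** b).
    by rewrite -one_sub_mul zt [z + t]addrC.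
  rewrite exprS -scalerA scalerBr -amulZr zE amulZr -scalerBr; congr (_ *: _).
  rewrite !amulBr !opprD !opprK st !addrA (addrAC s); congr (_ + _).
  by rewrite !amulA tt0.
Qed.

(** Here [1 - z] is [cos a] times the product of the [cos (2^j a)] for [j <= n], so that
    [b - z b = 2^-(n+1) cos a sin (2^(n+1) a)]. The additional factor [cos a] makes [z] a polynomial
    in [b], as [cos^2 a = 1 - b^2]; thus [z] is in [D] without assuming this of [t0]. *)
Lemma double_angle_steps n :
  D b -> adj b = b -> adj t0 = t0 -> t0 ** b = b ** t0 ->
  t0 + t0 = b ** b + t0 ** t0 -> exists z,
  [/\ D z, adj z = z, z ** b = b ** z, forall x, `|x - z ** x| <= `|x|
    & `|b - z ** b| <= 2^-1 ^+ n.+1].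
Proof.
move=> Db bsa tsa tb tE.
have bbE : b ** b = t0 + t0 - t0 ** t0 by rewrite tE addrK.
have contr x : `|x - t0 ** x| <= `|x|.
  by have [] := sin_cos_le x bsa tsa (esym tb) tE.
have b0 : invariant 0.
  exists (b ** b), (2 *: (b ** b)), (2 *: (b - b ** t0)).
  have adj2 x : adj (2 *: x) = 2 *: adj x by rewrite adjZ conjC_nat.
  have bbt : b ** b ** t0 = t0 ** (b ** b) by rewrite -amulA -tb amulA -tb amulA.
  split.
  - split; rewrite ?adj2 ?adjB ?adjM ?bsa ?tsa ?tb//.
      exact: starSubM.
    by apply: starSubZ; exact: starSubM.
  - split.
    + rewrite !amulZl !amulZr; do 2!congr (_ *: _); rewrite amulBl amulBr.
      congr (_ - _); first by rewrite amulA.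
      by rewrite -amulA -bbt !amulA.
    + rewrite amulZl amulZr amulBl amulBr -tb; congr (_ *: (_ - _)).
      by rewrite -!amulA tb.
    + by rewrite amulZl amulZr bbt.
    + by rewrite amulZl amulZr.
  - split; last exact: double_angle (esym tb) tE.
      by rewrite amulA.
    by rewrite amulZl amulZr amulA.
  - move=> x; rewrite bbE one_sub_mul; exact: le_trans (contr _) (contr _).
  - by rewrite expr1 bbE one_sub_mul amulZr -scalerBr tb.
have [z [t [s [[Dz Dt ssa tsa' zsa] [st st0 tt0 zt] [zb tb' tE'] zle zE]]]] : invariant n.
  by elim: n => // n ih; exact: double.
exists z; split => //.
have n0 : 0 < 2 ^+ n.+1 :> R[i] by rewrite exprn_gt0.
rewrite exprVn -[leRHS]mulr1 ler_pdivlMl// -[X in X * _]gtr0_norm// -normrZ zE.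
exact: le_trans (contr s) (sa_le1 ssa tsa' (esym st) tE').
Qed.

End DoublingSteps.

Lemma sa_decomposition (D : starSub A) x : D x ->
  exists y z, [/\ D y, D z, adj y = y, adj z = z & x = y + 'i *: z].
Proof.
move=> Dx.
have iE : ('i : R[i])^* = - 'i by exact: conjCi.
have ii : 'i * 'i = -1 :> R[i] by rewrite -expr2 sqrCi.
have Dax := starSub_adj Dx.
exists (2^-1 *: (x + adj x)), (2^-1 *: ('i *: (adj x - x))); split.
- by apply: starSubZ; exact: starSubD.
- apply: starSubZ; apply: starSubZ; rewrite -scaleN1r.
  by apply: starSubD => //; exact: starSubZ.
- by rewrite adj_half adjD adjK addrC.
- by rewrite adj_half adjZ iE adjB adjK scaleNr -scalerN opprB.
- rewrite ['i *: (2^-1 *: _)]scalerA mulrC -scalerA ['i *: ('i *: _)]scalerA.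
  rewrite ii scaleN1r opprB -scalerDr.
  by rewrite addrACA addrN addr0 -dbl_scale scalerA mulVf ?scale1r.
Qed.

Lemma local_unit_sa (D : cstarSub A) b (e : R[i]) :
  D b -> adj b = b -> 0 < e -> exists z,
  [/\ D z, adj z = z, z ** b = b ** z, forall x, `|x - z ** x| <= `|x|
    & `|b - z ** b| < e].
Proof.
move=> Db bsa e0.
(* Scaling makes [c b] the sine of an angle: its square has norm at most 1/2, as [sqrt_one_sub]
   requires. The [+ 1] covers [b = 0]. *)
pose c : R[i] := (2 * (`|b| + 1))^-1.
have b1 : 0 < `|b| + 1 by rewrite ltr_wpDl.
have c0 : 0 < c by rewrite invr_gt0 mulr_gt0.
have cb : `|c *: b| <= 2^-1.
  rewrite normrZ gtr0_norm// /c invfM -mulrA ler_piMr ?invr_ge0//.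
  by rewrite ler_pdivrMl// mulr1 lerDl.
have csa : adj (c *: b) = c *: b by rewrite adjZ bsa geC0_conj// ltW.
have Dcb : D (c *: b) by exact: starSubZ.
have [|||t [_ tsa tc tE]] := @sqrt_one_sub R A D ((c *: b) ** (c *: b)).
- exact: starSubM.
- by rewrite adjM csa.
- rewrite norm_sa2// expr2 -[leRHS]mulr1.
  by rewrite ler_pM// (le_trans cb)// invf_le1// ler1n.
have [n nP] := @div_natr_lt R 1 (c * e) ler01 (mulr_gt0 c0 e0).
have tb : t ** (c *: b) = (c *: b) ** t by rewrite -tc// amulA.
have [z [Dz zsa zb zle zE]] := @double_angle_steps D _ _ n Dcb csa tsa tb tE.
exists z; split => //.
  move: zb; rewrite amulZl amulZr => /(congr1 (fun x => c^-1 *: x)).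
  by rewrite !scalerA mulVf ?scale1r// gt_eqF.
move: zE; rewrite amulZr -scalerBr normrZ gtr0_norm// => zE.
have ne : 2^-1 ^+ n < c * e := le_lt_trans (half_pow_le R n) (nP n (leqnn n)).
rewrite -(ltr_pM2l c0); apply: le_lt_trans ne; apply: le_trans zE _.
by rewrite exprS ler_piMl ?exprn_ge0 ?invr_ge0// invf_le1// ler1n.
Qed.

(** For [z] adapted to [x ** adj x], the C*-identity bounds [|x - z x|^2] by the norm of
    [(1 - z) x (adj x)]; hence the tolerance [e^2]. *)
Lemma local_unit (D : cstarSub A) x (e : R[i]) :
  D x -> 0 < e -> exists z,
  [/\ D z, adj z = z, forall x, `|x - z ** x| <= `|x| & `|x - z ** x| < e].
Proof.
move=> Dx e0.
have [|||z [Dz zsa _ zle zE]] := @local_unit_sa D (x ** adj x) (e ^+ 2).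
- by apply: starSubM => //; exact: starSub_adj.
- by rewrite adjM adjK.
- by rewrite exprn_gt0.
exists z; split => //.
rewrite -(@ltr_pXn2r _ 2)// ?nnegrE ?(ltW e0)//= -[`|x - _|]norm_adj.
rewrite -norm_adjM adjK.
set d := x ** adj x - _ in zE.
have -> : (x - z ** x) ** adj (x - z ** x) = d - d ** z.
  by rewrite adjB adjM zsa amulBr [_ ** (_ ** z)]amulA !amulBl -!amulA.
by rewrite -norm_adj adjB adjM zsa (le_lt_trans (zle _))// norm_adj.
Qed.

End LocalUnits.

(** * Hereditary subalgebras *)

Section Hereditary.
Variables (R : realType) (A : cstarAlgType R) (D E : cstarSub A).
Hypothesis hE : hereditary D E.
Implicit Types (a b y h : A).

Let ED a : E a -> D a. Proof. by have [+ _] := hE; apply. Qed.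

Lemma starSubN (F : starSub A) y : F y -> F (- y).
Proof. by rewrite -scaleN1r; exact: starSubZ. Qed.

Lemma starSubB (F : starSub A) y h : F y -> F h -> F (y - h).
Proof. by move=> Fy /starSubN; exact: starSubD. Qed.

(** If [(1 - t)^2 = 1 - h], the difference is [adj c ** c] with [c = a - t a]. *)
Lemma pos_compress a h : D a -> D h -> adj h = h -> `|h| <= 2^-1 ->
  cstar_pos D (adj a ** a - adj a ** h ** a).
Proof.
move=> Da Dh hsa h2; have [t [Dt tsa _ tE]] := sqrt_one_sub Dh hsa h2.
exists (a - t ** a); first by apply: starSubB => //; exact: starSubM.
have -> : h = t + t - t ** t by rewrite tE addrK.
rewrite adjB adjM tsa !(amulBl, amulBr, amulDr, amulDl) -!amulA.
by rewrite !opprD !opprK !addrA.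
Qed.

(** The element [(adj a)(1 - h) a] lies between 0 and [2 (adj a) a], the upper bound being
    [pos_compress] for [- h]; so it is in [E] by heredity. *)
Let sandwich_small a h : E a -> D h -> adj h = h -> `|h| <= 2^-1 ->
  E (adj a ** h ** a).
Proof.
move=> Ea Dh hsa h2; have Da := ED Ea.
have Eaa : E (adj a ** a) by apply: starSubM => //; exact: starSub_adj.
suff Eb : E (adj a ** a - adj a ** h ** a).
  by rewrite -[_ ** h ** a](subKr (adj a ** a)); exact: starSubB.
have [_ hered] := hE; apply: (hered _ (adj a ** a + adj a ** a)).
- apply: starSubB; first exact: ED.
  by do 2?apply: starSubM => //; exact: starSub_adj.
- exact: starSubD.
- exact: pos_compress.
- have -> : adj a ** a + adj a ** a - (adj a ** a - adj a ** h ** a) =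
      adj a ** a - adj a ** (- h) ** a.
    by rewrite amulrN amulNr opprK opprB addrACA subrr addr0.
  by apply: pos_compress; rewrite ?adjN ?hsa ?normrN//; exact: starSubN.
Qed.

Let sandwich_sa a h : E a -> D h -> adj h = h -> E (adj a ** h ** a).
Proof.
move=> Ea Dh hsa; pose c : R[i] := (2 * (`|h| + 1))^-1.
have h1 : 0 < `|h| + 1 by rewrite ltr_wpDl.
have c0 : 0 < c by rewrite invr_gt0 mulr_gt0.
have : E (adj a ** (c *: h) ** a).
  apply: sandwich_small => //; first exact: starSubZ.
    by rewrite adjZ hsa geC0_conj// ltW.
  rewrite normrZ gtr0_norm// /c invfM -mulrA ler_piMr ?invr_ge0//.
  by rewrite ler_pdivrMl// mulr1 lerDl.
rewrite amulZr amulZl => /(starSubZ c^-1).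
by rewrite scalerA mulVf ?scale1r// gt_eqF.
Qed.

(** Polarization: the mixed terms of [q] at [(a, b)] and at [(a, i b)] together isolate
    [adj a ** h ** b]. *)
Let sandwich_polar a b h : E a -> E b -> D h -> adj h = h -> E (adj a ** h ** b).
Proof.
move=> Ea Eb Dh hsa; pose q x := adj x ** h ** x.
have ii : 'i * 'i = -1 :> R[i] by rewrite -expr2 sqrCi.
have iE : ('i : R[i])^* = - 'i by exact: conjCi.
have Eq x : E x -> E (q x) by move=> Ex; exact: sandwich_sa.
have qD x y : q (x + y) - q x - q y = adj x ** h ** y + adj y ** h ** x.
  rewrite /q adjD !(amulDl, amulDr); apply/eqP; rewrite !subr_eq; apply/eqP.
  by rewrite [RHS](ACl (4*1*(2*3)))%AC.
have qE : 2 *: (adj a ** h ** b) =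
    (q (a + b) - q a - q b) - 'i *: (q (a + 'i *: b) - q a - q ('i *: b)).
  rewrite !qD adjZ iE !(amulZr, amulZl) scalerDr !scalerA mulrN ii opprK.
  by rewrite scaleN1r scale1r opprD opprK addrACA subrr addr0 -dbl_scale.
have : E (2 *: (adj a ** h ** b)).
  rewrite qE; apply: starSubB; last apply: starSubZ;
    do 2?apply: starSubB; apply: Eq => //; try exact: starSubZ.
    exact: starSubD.
  by apply: starSubD => //; exact: starSubZ.
by move=> /(starSubZ 2^-1); rewrite scalerA mulVf ?scale1r.
Qed.

(** Converts heredity from its order form to the multiplicative form in which it is used, by
    splitting [y] into real and imaginary parts. *)
Lemma hereditary_sandwich a b y : E a -> E b -> D y -> E (a ** y ** b).
Proof.
move=> Ea Eb /sa_decomposition[h [k [Dh Dk hsa ksa ->]]].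
rewrite -[a]adjK amulDr amulDl amulZr amulZl.
by apply: starSubD; last apply: starSubZ; apply: sandwich_polar => //;
  exact: starSub_adj.
Qed.

End Hereditary.

(** Provides approximants that are products of four elements of [E], the shape handled by
    [twisted_limit_null]. *)
Lemma sa_approx (R : realType) (A : cstarAlgType R) (E : cstarSub A) (b : A)
    (e : R[i]) : E b -> adj b = b -> 0 < e ->
  exists2 z, E z & `|b - z ** z ** b ** z| < e.
Proof.
move=> Eb bsa e0.
(* [7 = 1 + 2 + 4]: the error is [(1 + z + z^2)(b - z b)], and multiplication by [z] at most doubles
   norms. *)
have [z [Ez zsa zb zle zE]] := local_unit_sa Eb bsa (divr_gt0 e0 (ltr0n _ 7)).
exists z => //.
have z2 x : `|z ** x| <= 2 * `|x|.
  rewrite -[z ** x](subKr x) (le_trans (ler_normB _ _))// mulr_natl mulr2n.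
  by rewrite lerD2l.
have -> : b - z ** z ** b ** z =
    (b - z ** b) + (z ** (b - z ** b) + z ** (z ** (b - z ** b))).
  by rewrite -!amulA -zb !amulBr !addrA !subrK.
rewrite (le_lt_trans (ler_normD _ _))//.
have -> : e = e / 7 + (2 * (e / 7) + 2 * (2 * (e / 7))) by field.
rewrite ltrD// (le_lt_trans (ler_normD _ _))// ltrD//.
  by rewrite (le_lt_trans (z2 _))// ltr_pM2l.
by rewrite (le_lt_trans (z2 _))// ltr_pM2l// (le_lt_trans (z2 _))// ltr_pM2l.
Qed.

(** * The action of the central sequence algebra on constants *)

Section ApproximateUnit.
Variables (R : realType) (A : cstarAlgType R).
Implicit Types (u x y z : A) (e : R[i]).

(** Induction on the list: [1 - u] is followed by a contraction [1 - z] that is small on the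
    residual [a - u a] and does not enlarge the earlier residuals. The estimate on [adj u] serves
    the symmetrization in [finite_unit]. *)
Lemma finite_left_unit (l : seq A) e : 0 < e -> exists u,
  [/\ forall x, `|x - u ** x| <= `|x|, forall x, `|x - adj u ** x| <= `|x|
    & {in l, forall a, `|a - u ** a| < e}].
Proof.
move=> e0; elim: l => [|a l [u [ule uale ul]]].
  by exists 0; split=> // x; rewrite ?adj0 amul0r subr0.
have [z [_ zsa zle za]] := @local_unit _ _ (cstarSubT A) (a - u ** a) e I e0.
exists (z + u - z ** u); split=> [x|x|b].
- by rewrite one_sub_mul (le_trans (zle _)).
- rewrite adjB adjD adjM zsa [z + _]addrC one_sub_mul.
  by rewrite (le_trans (uale _)).
- rewrite inE one_sub_mul => /orP[/eqP->//|/ul].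
  exact: le_lt_trans.
Qed.

Lemma finite_unit (l : seq A) e : 0 < e -> exists u,
  [/\ adj u = u, `|u| <= 2, forall x, `|x - u ** x| <= `|x|
    & {in l, forall a, `|a - u ** a| < e}].
Proof.
move=> /(finite_left_unit l)[v [vle vale vl]].
(* Chosen so that [1 - u = (1 - adj v)(1 - v)]. *)
pose u := adj v + v - adj v ** v.
have usa : adj u = u by rewrite adjB adjD adjM !adjK [v + _]addrC.
have uE x : x - u ** x = (x - v ** x) - adj v ** (x - v ** x).
  exact: one_sub_mul.
have ule x : `|x - u ** x| <= `|x| by rewrite uE (le_trans (vale _)).
exists u; split => // [|a /vl]; last by rewrite uE; exact: le_lt_trans.
(* [|u|^2 = |u^2| <= |u| + |u - u^2| <= 2 |u|]. *)
have [->|u0] := eqVneq u 0; first by rewrite normr0.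
rewrite -(ler_pM2r (_ : 0 < `|u|)) ?normr_gt0// -expr2 -norm_sa2//.
rewrite -[u ** u](subKr u) (le_trans (ler_normB _ _))// mulr_natl mulr2n.
by rewrite lerD2l.
Qed.

Lemma approximate_unit : separable [set: A] -> exists u : nat -> A,
  [/\ forall n, `|u n| <= 2, forall a, (fun n => u n ** a) @ \oo --> a
    & forall a, (fun n => a ** u n) @ \oo --> a].
Proof.
move=> [S [+ _ Sdense]].
have Sball (a : A) e : 0 < e -> exists2 s, S s & `|a - s| < e.
  move=> e0; have [s [Ss +]] := Sdense a I _ (nbhsx_ballx a e e0).
  by rewrite -ball_normE; exists s.
(* A dense set is nonempty, so the countable [S] is enumerated by a sequence [f]; [u n] below
   handles its first [n + 1] terms up to [1 / (n + 1)]. *)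
move=> /pfcard_geP[S0|[f]].
  by have [s] := Sball 0 1 ltr01; rewrite S0.
have /choice[u uP] (n : nat) : exists v : A, [/\ adj v = v, `|v| <= 2,
    forall x, `|x - v ** x| <= `|x|
    & {in [seq f i | i <- iota 0 n.+1], forall a, `|a - v ** a| < 1 / n.+1%:R}].
  by apply: finite_unit; rewrite divr_gt0// ltr0Sn.
have ul (a : A) : (fun n => u n ** a) @ \oo --> a.
  suff ul0 : (fun n => u n ** a - a) @ \oo --> (0 : A).
    by apply: (cvg_eq ul0); exact: cvg_cst.
  apply/cvgr0Pnorm_lt => e e0.
  have e2 : 0 < e / 2 by rewrite divr_gt0.
  have [s /(@surj _ _ _ _ f)[k _ fk] ks] := Sball a _ e2.
  have [n nP] := div_natr_lt ler01 e2.
  exists (maxn k n) => // m /=; rewrite geq_max => /andP[km nm].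
  rewrite distrC; have [_ _ ule uls] := uP m.
  have -> : a - u m ** a = ((a - s) - u m ** (a - s)) + (s - u m ** s).
    by rewrite amulBr opprB !addrA [RHS](ACl ((1*4)*((2*5)*(3*6))))%AC /= addNr subrr !addr0.
  rewrite [e]splitr (le_lt_trans (ler_normD _ _))// ltrD//.
    exact: le_lt_trans (ule _) ks.
  apply: lt_trans (nP m nm); apply: uls; rewrite -fk.
  by apply: map_f; rewrite mem_iota.
exists u; split=> // [n|a]; first by have [] := uP n.
have := cvg_adj (ul (adj a)); rewrite adjK.
rewrite (_ : (fun n => _) = (fun n => a ** u n))//.
by apply/funext => n; rewrite adjM adjK; have [-> _ _ _] := uP n.
Qed.

End ApproximateUnit.

(** * Multiplication of constants by classes in F(A, A) *)

Section CentralAction.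
Variables (R : realType) (A : cstarAlgType R).
Local Notation D := (cstarSubT A).
Implicit Types (a b w : A) (p q : central_alg D) (x : Defs.comm_alg D).

(** Independent of the representative, since two lifts of [q] differ by an element annihilating [A].
    It moves computations from F(A, A) to [Ainf A]. *)
Definition central_act q a : Ainf A := val (qrepr q) ** cst_Ainf a.

Lemma central_act_qpi x a : central_act (qpi (ann_ideal D) x) a = val x ** cst_Ainf a.
Proof.
apply/eqP; rewrite -subr_eq0 -amulBl; apply/eqP.
have h : annihilating (qrepr (qpi (ann_ideal D) x) - x) := qrepr_sub (ann_ideal D) x.
by have [+ _] := h a I; rewrite raddfB.
Qed.

Lemma central_actD p q a : central_act (p + q) a = central_act p a + central_act q a.
Proof. by rewrite -[p]qreprK -[q]qreprK -qpiD !central_act_qpi raddfD amulDl. Qed.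

Lemma central_actZ (k : R[i]) q a : central_act (k *: q) a = k *: central_act q a.
Proof. by rewrite -[q]qreprK -qpiZ !central_act_qpi linearZ/= amulZl. Qed.

Lemma central_actM p q a :
  central_act (p ** q) a = val (qrepr p) ** central_act q a.
Proof.
by rewrite -{1}[p]qreprK -[q]qreprK -qpiM !central_act_qpi val_amul amulA.
Qed.

Lemma cst_Ainf_eq0 a : cst_Ainf a = 0 -> a = 0.
Proof.
rewrite -(qpi0 (c0_ideal A)) => /qpi_eq; rewrite subr0 => a0.
exact: (@cvg_uniq _ _ (fun=> a) (fun=> a) _ _ (fun=> erefl) (cvg_cst _) a0).
Qed.

Lemma Ainf_adjM_eq0 (q : Ainf A) : adj q ** q = 0 -> q = 0.
Proof.
rewrite -[q]qreprK -qpi_adj -qpiM -(qpi0 (c0_ideal A)) => /qpi_eq q0.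
apply/qpi_eq; move: q0; rewrite !subr0 => /null_seqP q0.
apply/null_seqP => e e0; have := q0 _ (exprn_gt0 2 e0).
apply: filterS => n /=; rewrite norm_adjM.
by rewrite ltr_pXn2r// ?nnegrE ?(ltW e0).
Qed.

(** C*-identity: if [x] is the product of [p] and [a], then [adj x ** x] is [(adj a) p^2 a]. *)
Lemma central_act_sa_eq0 p a : adj p = p ->
  central_act (p ** p) a = 0 -> central_act p a = 0.
Proof.
move=> psa; rewrite -{1}psa -[p]qreprK -qpi_adj -qpiM !central_act_qpi => p0.
apply: Ainf_adjM_eq0; rewrite adjM -amulA (amulA (adj _) _ (cst_Ainf a)).
by rewrite -val_adj -val_amul p0 amulr0.
Qed.

(** [A] may lack a unit, but an approximate unit gives a class [q] acting as the identity on
    constants, whence [a = q a = (e q) a = e a] in [Ainf A]. *)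
Lemma unit_act_faithful e a : separable [set: A] -> is_unit e ->
  central_act e a = 0 -> a = 0.
Proof.
move=> /approximate_unit[u [u2 ul ur]] eU ea0.
have ub : bounded_seq u by exists 2.
pose U : linf A := mkSub (S := linf_sub A) ub.
have Ul b : qpi (c0_ideal A) U ** cst_Ainf b = cst_Ainf b.
  rewrite -qpiM; apply/qpi_eq.
  suff : (fun n => u n ** b - b) @ \oo --> b - b by rewrite subrr.
  by apply: cvgB; [exact: ul|exact: cvg_cst].
have Ur b : cst_Ainf b ** qpi (c0_ideal A) U = cst_Ainf b.
  rewrite -qpiM; apply/qpi_eq.
  suff : (fun n => b ** u n - b) @ \oo --> b - b by rewrite subrr.
  by apply: cvgB; [exact: ur|exact: cvg_cst].
have Uc : commuting D (qpi (c0_ideal A) U) by move=> b _; rewrite Ul Ur.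
pose q := qpi (ann_ideal D) (mkSub (S := comm_sub D) Uc).
have qE b : central_act q b = cst_Ainf b by rewrite central_act_qpi Ul.
apply: cst_Ainf_eq0; rewrite -qE -(eU q).1 central_actM qE.
exact: ea0.
Qed.

End CentralAction.

(** * Absolutely convergent series over the integers *)

Lemma zpartialS (V : zmodType) (u : int -> V) N :
  zpartial u N.+1 = zpartial u N + (u (- N.+1%:Z) + u N.+1%:Z).
Proof.
rewrite /zpartial doubleS big_ord_recl big_ord_recr /= addrCA; congr (_ + (_ + _)).
- by apply: eq_bigr => i _; congr u; rewrite /bump /=; lia.
- by congr u; lia.
- by congr u; rewrite /bump /=; lia.
Qed.

Section AbsoluteConvergence.
Variables (R : realType) (f : int -> R[i]).
Hypothesis f1 : ell1 f.

Let t := zpartial (fun n => complex.Re `|f n|).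

Let fE n : `|f n| = (complex.Re `|f n|)%:C. Proof. exact: ge0_complexE. Qed.
Let f_ge0 n : 0 <= complex.Re `|f n|. Proof. rewrite -lecR -fE; exact: normr_ge0. Qed.

Let t_nd N : t N <= t N.+1.
Proof. by rewrite /t zpartialS lerDl addr_ge0. Qed.

Let t_ub : exists M, forall N, t N <= M.
Proof.
move: f1; rewrite /ell1 /summable.
set S := (X in (X < _)%E) => Sfin.
have S0 : (0 <= S)%E by exact: esum_ge0.
exists (fine S) => N; rewrite -lee_fin fineK ?ge0_fin_numE//.
pose r := [seq k%:Z - N%:Z | k <- iota 0 N.*2.+1].
apply: esum_ge; exists [set` r].
  split; [exact: finite_seq|exact: subsetT].
rewrite -fsbig_seq; last first.
  by rewrite map_inj_uniq ?iota_uniq// => i j /=; lia.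
rewrite /r big_map -[X in iota 0 X]subn0 -/(index_iota _ _) big_mkord -sumEFin.
by apply: lee_sum => i _; rewrite lee_fin ler_norm.
Qed.

Lemma ell1_tail (e : R) : 0 < e -> exists n, forall m, (n <= m)%N ->
  t m - t n < e.
Proof.
move=> e0; have [M tM] := t_ub.
have hs : has_sup (range t) by split; [exists (t 0), 0|exists M => _ [n _ <-]].
have [_ [n _ <-] nP] := sup_adherent e0 hs.
exists n => m _; rewrite ltrBlDr -ltrBlDl (le_lt_trans _ nP)// lerB//.
by apply: ub_le_sup; [exact: hs.2|exists m].
Qed.

Lemma zpartial_dist (V : normedModType R[i]) (u : int -> V) (C : R[i]) n m :
  (n <= m)%N -> (forall k, `|u k| <= C * `|f k|) ->
  `|zpartial u m - zpartial u n| <= C * (t m - t n)%:C.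
Proof.
move=> /subnKC <- uC; elim: (m - n)%N => [|k ih].
  by rewrite addn0 !subrr normr0 mulr0.
rewrite addnS /t !zpartialS -/t addrAC (le_trans (ler_normD _ _))//.
rewrite [X in X%:C]addrAC rmorphD mulrDr lerD// (le_trans (ler_normD _ _))//.
by rewrite rmorphD mulrDr lerD// (le_trans (uC _))// {1}fE.
Qed.

(** The index [n] works for all [u] dominated by [C |f|]; this uniformity later permits exchanging
    the sum over the integers with a limit along a sequence. *)
Lemma zpartial_tail (V : normedModType R[i]) (C e : R[i]) :
  0 <= C -> 0 < e -> exists n, forall m (u : int -> V), (n <= m)%N ->
  (forall k, `|u k| <= C * `|f k|) -> `|zpartial u m - zpartial u n| < e.
Proof.
move=> C0 e0; set c := complex.Re C; set d := complex.Re e.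
have dE : e = d%:C := ge0_complexE (ltW e0).
have cE : C = c%:C := ge0_complexE C0.
have d0 : 0 < d by rewrite -ltcR -dE.
have c0 : 0 <= c by rewrite -lecR -cE.
have c1 : 0 < c + 1 by rewrite ltr_wpDl.
have [n nP] := ell1_tail (divr_gt0 d0 c1).
exists n => m u nm uC; rewrite (le_lt_trans (zpartial_dist nm uC))//.
rewrite cE dE -rmorphM ltcR.
have := nP m nm; rewrite ltr_pdivlMr// mulrC; apply: le_lt_trans.
rewrite ler_wpM2r ?lerDl// subr_ge0 -(subnKC nm).
by elim: (m - n)%N => [|k ih]; rewrite ?addn0// addnS (le_trans ih).
Qed.

Lemma zpartial_bound (V : normedModType R[i]) : exists2 M : R[i], 0 < M &
  forall (u : int -> V) (C : R[i]) m,
  0 <= C -> (forall k, `|u k| <= C * `|f k|) -> `|zpartial u m| <= C * M.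
Proof.
have [M tM] := t_ub; have M0 : 0 <= M.
  by apply: le_trans (tM 0%N); apply: sumr_ge0.
exists (M + 1)%:C => [|u C m C0 uC]; first by rewrite ltcR ltr_wpDl.
apply: (@le_trans _ _ (C * (t m)%:C)); last first.
  by rewrite ler_wpM2l// lecR (le_trans (tM m))// lerDl.
rewrite /t /zpartial rmorph_sum/= mulr_sumr (le_trans (ler_norm_sum _ _ _))//.
by apply: ler_sum => k _; rewrite -fE.
Qed.

Lemma zpartial_cvg (V : completeNormedModType R[i]) (u : int -> V) (C : R[i]) :
  0 <= C -> (forall k, `|u k| <= C * `|f k|) ->
  exists a : V, zpartial u @ \oo --> a.
Proof.
move=> C0 uC; apply: cauchy_seq_cvg => e /(zpartial_tail V C0)[n nP].
by exists n => m nm; exact: nP.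
Qed.

End AbsoluteConvergence.

(** * Rotation of annihilating Fourier coefficients *)

Section Rotation.
Variables (R : realType) (A : cstarAlgType R).
Implicit Types (a b w x : A).

Lemma zpartialB (V : zmodType) (u v : int -> V) N :
  zpartial (fun k => u k - v k) N = zpartial u N - zpartial v N.
Proof. by rewrite /zpartial sumrB. Qed.

Lemma zpartialD (V : zmodType) (u v : int -> V) N :
  zpartial (fun k => u k + v k) N = zpartial u N + zpartial v N.
Proof. by rewrite /zpartial big_split. Qed.

Lemma zpartialZ (c : R[i]) (u : int -> A) N :
  zpartial (fun k => c *: u k) N = c *: zpartial u N.
Proof. by rewrite /zpartial scaler_sumr. Qed.

Lemma zpartial_amul (u : int -> A) x N :
  x ** zpartial u N = zpartial (fun k => x ** u k) N.
Proof.
rewrite /zpartial; apply: (big_morph (amul x)); first by move=> a b; exact: amulDr.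
exact: amulr0.
Qed.

Lemma cvg_zpartial0 (u : nat -> int -> A) N :
  (forall k, (fun n => u n k) @ \oo --> (0 : A)) ->
  (fun n => zpartial (u n) N) @ \oo --> (0 : A).
Proof.
move=> u0; elim: N => [|N ih].
  rewrite (_ : (fun n => _) = fun n => u n 0%Z)//.
  by apply/funext => n; rewrite /zpartial big_ord1.
rewrite (_ : (fun n => _) = fun n =>
  zpartial (u n) N + (u n (- N.+1%:Z) + u n N.+1%:Z)); last first.
  by apply/funext => n; exact: zpartialS.
by rewrite -[0]addr0; apply: cvgD => //; rewrite -[0]addr0; exact: cvgD.
Qed.

Lemma cvg0_mull x (u : nat -> A) : u @ \oo --> (0 : A) ->
  (fun n => x ** u n) @ \oo --> (0 : A).
Proof. by move=> /(@cvg_amull _ _ x); rewrite amulr0. Qed.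

Lemma cvg0_mulr x (u : nat -> A) : u @ \oo --> (0 : A) ->
  (fun n => u n ** x) @ \oo --> (0 : A).
Proof. by move=> /(@cvg_amulr _ _ x); rewrite amul0r. Qed.

Lemma cvg0_scale (c : R[i]) (u : nat -> A) : u @ \oo --> (0 : A) ->
  (fun n => c *: u n) @ \oo --> (0 : A).
Proof. by move=> u0; rewrite -(scaler0 _ c); exact: cvgZr. Qed.

Variables (theta : int -> A -> A) (f : int -> R[i]) (omega : R[i]).
Hypothesis theta_hom : forall k, star_hom (theta k).
Hypothesis f1 : ell1 f.
Hypothesis omega1 : `|omega| = 1.

(** The Fourier transform of [F] at [z] is that of [f] at [omega z]. *)
Let F k := f k * omega ^ k.

Let norm_omegaX k : `|omega ^ k| = 1.
Proof. by case: k => k; rewrite /exprz ?normfV normrX omega1 expr1n ?invr1. Qed.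

Let F_le k b : `|F k *: theta k b| <= `|b| * `|f k|.
Proof.
rewrite normrZ normrM norm_omegaX mulr1 mulrC ler_wpM2r//.
exact: star_hom_le.
Qed.

Let f_le k b : `|f k *: theta k b| <= `|b| * `|f k|.
Proof. by rewrite normrZ mulrC ler_wpM2r//; exact: star_hom_le. Qed.

Variable D E : cstarSub A.
Hypothesis hereditary_DE : hereditary D E.
Hypothesis hereditary_D : hereditary (cstarSubT A) D.
Hypothesis f_kills : forall a, E a ->
  zpartial (fun k => f k *: theta k a) @ \oo --> (0 : A).

(* [f] kills [a1 ** a2 ** y n ** a3 ** a4], which belongs to [E]. *)
Lemma twisted_limit_null (y : nat -> A) a1 a2 a3 a4 w :
  bounded_seq y -> (forall d, (fun n => d ** y n - y n ** d) @ \oo --> (0 : A)) ->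
  (forall k d, (fun n => (theta k (y n) - omega ^ k *: y n) ** d) @ \oo --> (0 : A)) ->
  E a1 -> E a2 -> E a3 -> E a4 ->
  zpartial (fun k => F k *: theta k (a1 ** a2 ** a3 ** a4)) @ \oo --> w ->
  (fun n => y n ** w) @ \oo --> (0 : A).
Proof.
move=> [Y yY] yc ye E1 E2 E3 E4; set b := a1 ** _ ** _ ** _ => bw.
have Y0 : 0 <= Y by exact: le_trans (yY 0%N).
(* [a2] and [a3] bring [y n] from [A] into [D], then [a1] and [a4] bring the result into [E]. *)
pose x n := a1 ** (a2 ** y n ** a3) ** a4.
have Ex n : E (x n).
  have DE a : E a -> D a by have [+ _] := hereditary_DE; apply.
  apply: (hereditary_sandwich hereditary_DE) => //.
  by apply: (hereditary_sandwich hereditary_D); [exact: DE|exact: DE|].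
have [C C0 xC] : exists2 C, 0 <= C & forall n, `|x n| <= C.
  exists (`|a1| * (`|a2| * Y * `|a3|) * `|a4|) => [|n].
    by rewrite !mulr_ge0.
  by do 4?[apply: le_trans (norm_amul _ _) _; apply: ler_pM => //].
(* Two errors, both vanishing in the limit for fixed [k]: the commutator of [y n] with a constant,
   and the failure of [y n] to be an eigenvector of [theta k]. *)
have xE k n : omega ^ k *: (y n ** theta k b) - theta k (x n) =
    (- omega ^ k) *: ((theta k (a1 ** a2) ** y n - y n ** theta k (a1 ** a2))
      ** theta k (a3 ** a4))
    - theta k (a1 ** a2) ** ((theta k (y n) - omega ^ k *: y n) ** theta k (a3 ** a4)).
  have [_ tM _] := theta_hom k.
  have -> : theta k (x n) = theta k (a1 ** a2) ** theta k (y n) ** theta k (a3 ** a4).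
    by rewrite -!tM /x !amulA.
  have -> : theta k b = theta k (a1 ** a2) ** theta k (a3 ** a4).
    by rewrite -tM /b !amulA.
  move: (theta k (a1 ** a2)) (theta k (a3 ** a4)) => p q.
  rewrite !amulBl amulBr amulZl amulZr scaleNr scalerBr !amulA !opprB.
  by rewrite addrA subrK.
have xc k : (fun n => omega ^ k *: (y n ** theta k b) - theta k (x n))
    @ \oo --> (0 : A).
  under eq_fun do rewrite xE.
  rewrite -[0](subrr 0); apply: cvgB.
    by apply: cvg0_scale; apply: cvg0_mulr; exact: yc.
  by apply: cvg0_mull; exact: ye.
apply/cvgr0Pnorm_lt => e e0.
(* One share for truncating [w], one for the finite sum as [n] grows, three for [v n]. The cutoff
   [N] is fixed before [n]. *)
have e5 : 0 < e / 5 by rewrite divr_gt0.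
have [N1 tailN] := zpartial_tail f1 A C0 e5.
have [N2 wN] : exists n, forall m, (n <= m)%N ->
    Y * `|w - zpartial (fun k => F k *: theta k b) m| < e / 5.
  have : (fun m => Y *: (w - zpartial (fun k => F k *: theta k b) m))
      @ \oo --> (0 : A).
    by apply: cvg0_scale; rewrite -(subrr w); apply: cvgB => //; exact: cvg_cst.
  move=> /cvg0_ex /(_ _ e5)[n nP]; exists n => m /nP.
  by rewrite normrZ ger0_norm.
pose N := maxn N1 N2.
pose v n := zpartial (fun k => f k *: theta k (x n)) N.
(* The full series at [x n] is zero. The index [m] depends on [n], but [N1] does not, so the bound
   at [N] is uniform in [n]. *)
have vE n : `|v n| < e / 5 + e / 5 + e / 5.
  have /cvg0_ex/(_ _ e5)[m mP] := f_kills (Ex n).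
  pose z m := zpartial (fun k => f k *: theta k (x n)) m.
  have tl m' : (N1 <= m')%N -> `|z m' - z N1| < e / 5.
    move=> /tailN; apply=> k; rewrite (le_trans (f_le _ _))//.
    by rewrite ler_wpM2r.
  have -> : v n = (z N - z N1) - (z (maxn m N1) - z N1) + z (maxn m N1).
    rewrite /v -/(z N); move: (z N) (z N1) (z (maxn m N1)) => p q r.
    by rewrite opprB addrA !subrK.
  rewrite (le_lt_trans (ler_normD _ _))// ltrD//; last exact/mP/leq_maxl.
  rewrite (le_lt_trans (ler_normB _ _))// ltrD//; first exact/tl/leq_maxl.
  exact/tl/leq_maxr.
have : (fun n => y n ** zpartial (fun k => F k *: theta k b) N - v n)
    @ \oo --> (0 : A).
  rewrite (_ : (fun n => _) = fun n =>
      zpartial (fun k => f k *: (omega ^ k *: (y n ** theta k b) - theta k (x n))) N).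
    by apply: cvg_zpartial0 => k; exact: cvg0_scale.
  apply/funext => n; rewrite zpartial_amul -zpartialB; congr (zpartial _ N).
  by apply/funext => k; rewrite scalerBr amulZr scalerA.
move=> /cvgr0Pnorm_lt/(_ _ e5); apply: filterS => n nP.
set wN' := zpartial (fun k => F k *: theta k b) N in nP.
have -> : y n ** w = y n ** (w - wN') + ((y n ** wN' - v n) + v n).
  by rewrite subrK amulBr subrK.
have -> : e = e / 5 + (e / 5 + (e / 5 + e / 5 + e / 5)) by field.
rewrite (le_lt_trans (ler_normD _ _))// ltrD//.
  rewrite (le_lt_trans (norm_amul _ _))// (le_lt_trans _ (wN N (leq_maxr _ _)))//.
  exact: ler_wpM2r.
by rewrite (le_lt_trans (ler_normD _ _))// ltrD.
Qed.

Hypothesis product_limit0 : forall a1 a2 a3 a4 w,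
  E a1 -> E a2 -> E a3 -> E a4 ->
  zpartial (fun k => F k *: theta k (a1 ** a2 ** a3 ** a4)) @ \oo --> w -> w = 0.

(** On fourfold products the series converges absolutely and its sum is 0 by [product_limit0]. These
    products approximate self-adjoint elements by [sa_approx], and partial sums are uniformly
    bounded operators; linearity does the rest. *)
Lemma twisted_kills b : E b -> zpartial (fun k => F k *: theta k b) @ \oo --> (0 : A).
Proof.
have thetaL k (c : R[i]) a a' : theta k (c *: a + a') = c *: theta k a + theta k a'.
  by have [] := theta_hom k.
have prod0 a1 a2 a3 a4 : E a1 -> E a2 -> E a3 -> E a4 ->
    zpartial (fun k => F k *: theta k (a1 ** a2 ** a3 ** a4)) @ \oo --> (0 : A).
  move=> E1 E2 E3 E4; set b' := a1 ** _ ** _ ** _.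
  have [w wP] := zpartial_cvg f1 (normr_ge0 b') (F_le^~ b').
  by have w0 := product_limit0 E1 E2 E3 E4 wP; rewrite w0 in wP.
have lin (c : R[i]) a a' :
    zpartial (fun k => F k *: theta k a) @ \oo --> (0 : A) ->
    zpartial (fun k => F k *: theta k a') @ \oo --> (0 : A) ->
    zpartial (fun k => F k *: theta k (c *: a + a')) @ \oo --> (0 : A).
  move=> a0 a'0; rewrite -[0 : A]addr0 -{1}(scaler0 _ c).
  rewrite (_ : zpartial _ = fun N => c *: zpartial (fun k => F k *: theta k a) N
    + zpartial (fun k => F k *: theta k a') N).
    by apply: cvgD => //; exact: cvgZr.
  apply/funext => N; rewrite -zpartialZ -zpartialD; congr (zpartial _ N).
  by apply/funext => k; rewrite thetaL scalerDr !scalerA mulrC.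
have sa_kill a : E a -> adj a = a ->
    zpartial (fun k => F k *: theta k a) @ \oo --> (0 : A).
  move=> Ea asa; apply/cvgr0Pnorm_lt => e e0.
  have [M M0 FM] := zpartial_bound f1 A.
  have [z Ez az] := sa_approx Ea asa (divr_gt0 (divr_gt0 e0 (ltr0n _ 2)) M0).
  have := prod0 z z a z Ez Ez Ea Ez.
  move=> /cvgr0Pnorm_lt/(_ _ (divr_gt0 e0 (ltr0n _ 2))).
  apply: filterS => n; set p := z ** _ ** _ ** _ => nP.
  have -> : zpartial (fun k => F k *: theta k a) n =
      zpartial (fun k => F k *: theta k (a - p)) n
      + zpartial (fun k => F k *: theta k p) n.
    rewrite -zpartialD; congr (zpartial _ n); apply/funext => k.
    by rewrite -scalerDr -[theta k (a - p)]scale1r -thetaL scale1r subrK.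
  rewrite [e]splitr (le_lt_trans (ler_normD _ _))// ltrD//.
  rewrite (le_lt_trans (FM _ _ _ (normr_ge0 (a - p)) (F_le^~ _)))//.
  by rewrite -ltr_pdivlMr.
move=> /sa_decomposition[a [c [Ea Ec asa csa ->]]].
by rewrite addrC; apply: lin; exact: sa_kill.
Qed.

End Rotation.

(** * Finite index subgroups and functions on cosets *)

Section Cosets.
Variables (G : groupType) (H : subgroup G).
Implicit Types (c d : cosets H) (s t g k x : G).

Lemma coset_inj c d : coset_set c = coset_set d -> c = d.
Proof.
case: c d => [c cP] [d dP] /= cd; rewrite cd in cP *.
by congr Coset; exact: Prop_irrelevance.
Qed.

Lemma coset_translateM s t c :
  coset_translate (s * t)%g c = coset_translate s (coset_translate t c).
Proof.
apply/coset_inj/seteqP; split=> [_ [x cx <-]|_ [_ [x cx <-] <-]].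
  by exists (t * x)%g; [exists x|rewrite mulgA].
by exists x => //; rewrite mulgA.
Qed.

Lemma coset_translate1 c : coset_translate 1%g c = c.
Proof.
apply/coset_inj/seteqP; split=> [_ [x cx <-]|x cx]; first by rewrite mul1g.
by exists x => //; rewrite mul1g.
Qed.

Lemma coset_translateK t : cancel (@coset_translate G H t) (coset_translate t^-1%g).
Proof. by move=> c; rewrite -coset_translateM mulVg coset_translate1. Qed.

Lemma coset_translateVK t : cancel (coset_translate t^-1%g) (@coset_translate G H t).
Proof. by move=> c; rewrite -coset_translateM mulgV coset_translate1. Qed.

(** The stabilizer of [x H] is the conjugate of [H] by [x], which is [H] by normality. *)
Lemma coset_translate_fix k c : normal_subgroup H ->
  coset_translate k c = c <-> H k.
Proof.
move=> nH; split=> [kc|].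
  have [x cE] := coset_ex c.
  have : coset_set c (k * x)%g.
    rewrite -kc; exists x => //; rewrite cE.
    by exists 1%g; [exact: subgroup1|rewrite mulg1].
  rewrite cE => -[h Hh kx].
  by rewrite -(mulgK x k) -kx; exact: nH.
have sub t : H t -> left_coset c t `<=` c.
  have [x ->] := coset_ex c => Ht _ [_ [h Hh <-] <-].
  exists (x^-1 * t * x * h)%g; last by rewrite !mulgA mulgV mul1g.
  apply: subgroupM => //; have := nH x^-1%g _ Ht.
  by rewrite invgK.
move=> Hk; apply/coset_inj/seteqP; split; first exact: sub.
move=> x cx; exists (k^-1 * x)%g; last by rewrite mulgA mulgV mul1g.
by apply: (sub k^-1%g); [exact: subgroupV|exists x].
Qed.

(** Otherwise the cosets of the powers of [g] would be pairwise distinct. *)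
Lemma finite_index_power g : finite_index H ->
  exists2 m, (0 < m)%N & H (g ^+ m)%g.
Proof.
move=> Hfin; apply: contrapT => noH.
pose cst x : cosets H := Coset (ex_intro _ x erefl).
have inj : injective (fun n => cst (g ^+ n)%g).
  suff lt i j : (i < j)%N -> cst (g ^+ i)%g <> cst (g ^+ j)%g.
    move=> i j ij; apply/eqP; case: (ltngtP i j) => // ji.
      by have := lt _ _ ji ij.
    by have := lt _ _ ji (esym ij).
  move=> ij /(congr1 (@coset_set G H)) /= cE; apply: noH.
  exists (j - i)%N; first by rewrite subn_gt0.
  have : left_coset H (g ^+ j)%g (g ^+ j)%g.
    by exists 1%g; [exact: subgroup1|rewrite mulg1].
  rewrite -cE => -[h Hh]; rewrite -{1}(subnKC (ltnW ij)) expgnDr.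
  by move=> /mulgI <-.
apply: infinite_nat; rewrite -(preimage_setT (fun n => cst (g ^+ n)%g)).
by apply: finite_preimage => // i j _ _; exact: inj.
Qed.

Lemma power_order g : finite_index H -> ~ H g ->
  exists m, [/\ (1 < m)%N, H (g ^+ m)%g
    & forall j, (0 < j < m)%N -> ~ H (g ^+ j)%g].
Proof.
move=> Hfin Hg; have ex : exists m, (0 < m)%N && `[< H (g ^+ m)%g >].
  by have [m m0 /asboolP Hm] := finite_index_power g Hfin; exists m; rewrite m0.
case: (ex_minnP ex) => m /andP[m0 /asboolP Hm] m_min; exists m; split => //.
  by case: m m0 Hm {m_min} => [|[|m]]//; rewrite expg1.
move=> j /andP[j0 jm] /asboolP Hj; have := m_min j.
by rewrite j0 Hj leqNgt jm => /(_ isT).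
Qed.

End Cosets.

(** Take a root of [1 + X + ... + X^(m-1)]: this polynomial divides [X^m - 1] and takes the nonzero
    value [m] at 1. *)
Lemma nontrivial_root1 (R : realType) m : (1 < m)%N ->
  exists omega : R[i], [/\ omega ^+ m = 1, omega != 1 & `|omega| = 1].
Proof.
move=> m1; pose p : {poly R[i]} := \poly_(i < m) 1.
have /closed_rootP[omega] : size p != 1%N.
  by rewrite size_poly_eq ?oner_neq0// gtn_eqF.
rewrite /root horner_poly; under eq_bigr do rewrite mul1r.
move=> /eqP sum0.
have om : omega ^+ m = 1.
  by apply/eqP; rewrite -subr_eq0 subrX1 sum0 mulr0.
exists omega; split => //.
  apply/eqP => o1; move: sum0; rewrite o1; under eq_bigr do rewrite expr1n.
  rewrite sumr_const card_ord => /eqP; rewrite pnatr_eq0.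
  by case: m m1 {p om}.
by apply/eqP; rewrite -(@eqrXn2 _ m) ?(ltnW m1)// -normrX om normr1 expr1n.
Qed.

(** * Eigenfunctions of translation on the space of cosets *)

Section CosetFunctions.
Variables (R : realType) (G : groupType) (H : subgroup G).
Hypothesis normalH : normal_subgroup H.
Local Notation C := (cosets H -> R[i]^o).
Implicit Types (c : cosets H) (u : C) (s t g : G).

Definition coset_delta c : C := fun d => (`[< d = c >])%:R.

Lemma coset_act_delta t c :
  coset_act t (coset_delta c) = coset_delta (coset_translate t c).
Proof.
apply/funext => d; congr (nat_of_bool _)%:R; apply: asbool_equiv_eq.
split=> [<-|->]; first by rewrite coset_translateVK.
by rewrite coset_translateK.
Qed.

Lemma coset_actM s t u : coset_act (s * t)%g u = coset_act s (coset_act t u).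
Proof. by apply/funext => c; rewrite /coset_act invgM coset_translateM. Qed.

Lemma coset_actK t : cancel (coset_act t) (coset_act t^-1%g : C -> C).
Proof.
by move=> u; apply/funext => c; rewrite /coset_act invgK coset_translateK.
Qed.

Definition int_pow g (k : int) : G :=
  match k with Posz n => (g ^+ n)%g | Negz n => (g ^- n.+1)%g end.

Lemma coset_act_eigen_pow g (omega : R[i]) u : omega != 0 ->
  coset_act g u = omega *: u -> forall k, coset_act (int_pow g k) u = omega ^ k *: u.
Proof.
move=> o0 gu.
have pos n : coset_act (g ^+ n)%g u = omega ^+ n *: u.
  elim: n => [|n ih].
    rewrite expg0 expr0 scale1r; apply/funext => c.
    by rewrite /coset_act invg1 coset_translate1.
  have actZ (k : R[i]) v : coset_act (g ^+ n)%g (k *: v) = k *: coset_act (g ^+ n)%g v by [].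
  by rewrite expgSr coset_actM gu actZ ih scalerA exprS.
(* For a negative power, [u] is rewritten as a multiple of its translate by [g^(n+1)], which the
   inverse translation undoes. *)
case=> n //=; rewrite -[X in coset_act _ X](_ : omega ^- n.+1 *: (omega ^+ n.+1 *: u) = u).
  by rewrite -pos; exact: (congr1 (fun v : C => omega ^- n.+1 *: v) (coset_actK _ _)).
by rewrite scalerA mulVf ?scale1r// expf_neq0.
Qed.

(** A discrete Fourier mode on the orbit of [c] under [g], normalized to have coefficient 1 on the
    term of [c] itself. *)
Definition orbit_wave g (omega : R[i]) m c : C :=
  \sum_(j < m) omega ^- j *: coset_delta (coset_translate (g ^+ j)%g c).

(** Translation sends term [j] to [omega] times term [j + 1]; the sum closes up because
    [omega^m = 1] and [g^m] fixes [c]. *)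
Lemma orbit_wave_eigen g (omega : R[i]) m c : (0 < m)%N -> omega ^+ m = 1 ->
  H (g ^+ m)%g ->
  coset_act g (orbit_wave g omega m c) = omega *: orbit_wave g omega m c.
Proof.
case: m => // m _ om Hm.
have o0 : omega != 0.
  by apply/eqP => o0; move/eqP: om; rewrite o0 expr0n /= eq_sym oner_eq0.
pose w j : C := omega ^- j *: coset_delta (coset_translate (g ^+ j)%g c).
have wS j : coset_act g (w j) = omega *: w j.+1.
  have -> : coset_act g (w j) =
    omega ^- j *: coset_act g (coset_delta (coset_translate (g ^+ j)%g c)) by [].
  rewrite coset_act_delta -coset_translateM -expgS /w scalerA exprS invfM mulrA.
  by rewrite mulfV// mul1r.
have actE : coset_act g (orbit_wave g omega m.+1 c) = \sum_(j < m.+1) omega *: w j.+1.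
  apply/funext => d; rewrite /coset_act /orbit_wave !fct_sumE.
  by apply: eq_bigr => j _; rewrite -wS.
rewrite actE -scaler_sumr; congr (_ *: _).
rewrite /orbit_wave big_ord_recr [RHS]big_ord_recl /= addrC; congr (_ + _).
rewrite /w om expr0 !invr1 !scale1r expg0 coset_translate1; congr coset_delta.
exact/(coset_translate_fix _ _ normalH).
Qed.

Lemma coset_delta_orth c d : c <> d ->
  orthogonal_elts (coset_delta c) (coset_delta d).
Proof.
move=> cd; have z (a b : cosets H -> R[i]^o) :
    (forall x, a x * b x = 0 :> R[i]) -> a ** b = 0.
  by move=> ab; apply/funext => x; exact: ab.
have d0 x : coset_delta c x = 0 \/ coset_delta d x = 0.
  rewrite /coset_delta; case: asboolP => [->|]; last by left.
  by case: asboolP => [//|]; right.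
have cj (a b : C) : (forall x, a x = 0 \/ b x = 0) ->
    a ** b = 0 /\ adj a ** b = 0.
  move=> ab; split; apply: z => x; first by case: (ab x) => ->; rewrite ?mulr0 ?mul0r.
  have -> : adj a x = (a x : R[i])^* by [].
  by case: (ab x) => ->; rewrite ?mulr0// rmorph0 mul0r.
have [dc dc'] := cj _ _ d0.
by have [|cd0 cd1] := cj (coset_delta d) (coset_delta c); first by move=> x; rewrite or_comm.
Qed.

(** Exhibits the delta function as positive, so that a completely positive map sends it to a
    self-adjoint element. *)
Lemma coset_delta_proj c : adj (coset_delta c) ** coset_delta c = coset_delta c.
Proof.
apply/funext => x.
have -> : (adj (coset_delta c) ** coset_delta c) x =
  (coset_delta c x : R[i])^* * (coset_delta c x : R[i]) by [].
by rewrite /coset_delta rmorph_nat -natrM mulnb andbb.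
Qed.

(** The constant 1 is a finite sum of delta functions; the induction runs over indicators [ind r] of
    lists of cosets. *)
Lemma coset_span (V : lmodType R[i]) (L : C -> V) : finite_index H ->
  (forall (k : R[i]) u v, L (k *: u + v) = k *: L u + L v) ->
  (forall c, L (coset_delta c) = 0) -> L (fun=> 1) = 0.
Proof.
move=> Hfin Llin Ldelta.
have L0 : L 0 = 0.
  by have := Llin (-1) 0 0; rewrite !scaleN1r addr0 oppr0 addNr.
have [s sE] : exists s : seq {classic cosets H}, [set: cosets H] = [set` s].
  exact/finite_seqP.
pose ind (r : seq {classic cosets H}) : C := fun c => ((c : {classic cosets H}) \in r)%:R.
have ind0 r : L (ind r) = 0.
  elim: r => [|c r ih].
    by rewrite (_ : ind _ = 0)//; apply/funext.
  have [cr|cr] := boolP (c \in r).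
    rewrite (_ : ind (c :: r) = ind r)//; apply/funext => d.
    by rewrite /ind inE; case: eqP => [->|//]; rewrite cr.
  rewrite (_ : ind (c :: r) = 1 *: coset_delta c + ind r).
    by rewrite Llin ih Ldelta scaler0 addr0.
  rewrite scale1r; apply/funext => d.
  have -> : (coset_delta c + ind r) d = coset_delta c d + ind r d by [].
  rewrite /ind /coset_delta inE; case: asboolP => [->|].
    by rewrite eqxx (negbTE cr) addr0.
  move=> dc; have -> : (d == c :> {classic cosets H}) = false by apply/eqP.
  by rewrite add0r.
rewrite -(ind0 s); congr L; apply/funext => c; rewrite /ind.
have : [set` s] (c : {classic cosets H}) by rewrite -sE.
by move=> /= ->.
Qed.

End CosetFunctions.

(** * Rokhlin towers *)

Section PowersOfAction.
Variables (R : realType) (A : cstarAlgType R) (G : groupType).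
Variable alpha : G -> starAut A.
Hypothesis alpha_action : is_action alpha.

Lemma action1 a : alpha 1%g a = a.
Proof. by apply: (can_inj (autK (alpha 1%g))); rewrite -alpha_action mulg1. Qed.

Lemma aut_pow_action g k : aut_pow (alpha g) k = alpha (int_pow g k).
Proof.
have iter_act (h : A -> A) s : h =1 alpha s -> forall n, iter n h =1 alpha (s ^+ n)%g.
  move=> hs; elim=> [|n ih] a; first by rewrite expg0 action1.
  by rewrite iterS ih hs expgS alpha_action.
apply/funext => a; case: k => n /=; first exact: iter_act.
have inv_act : aut_inv (alpha g) =1 alpha g^-1%g.
  move=> b; apply: (can_inj (autK (alpha g))).
  by rewrite autVK -alpha_action mulgV action1.
by rewrite -expVgn -(iter_act _ _ inv_act n.+1).
Qed.

End PowersOfAction.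

Section RokhlinTowers.
Variables (R : realType) (A : cstarAlgType R) (G : groupType).
Variables (alpha : G -> starAut A) (H : subgroup G) (d : nat).
Hypotheses (A_sep : separable [set: A]) (alpha_action : is_action alpha).
Hypotheses (normalH : normal_subgroup H) (finH : finite_index H).
Hypothesis towers : rokhlin_towers alpha H d.
Variable g : G.
Hypothesis Hg : ~ H g.

(** One [omega] serves all [D] and [E], so the conclusion passes to intersections of spectra. *)
Lemma rokhlin_rotation : exists omega : R[i], omega != 1 /\
  forall D E : cstarSub A, hereditary (cstarSubT A) D -> hereditary D E ->
  arveson_sp (alpha g) E 1 -> arveson_sp (alpha g) E omega.
Proof.
have [m [m1 Hm m_min]] := power_order finH Hg.
have [omega [om o1 on]] := nontrivial_root1 R m1.
have o0 : omega != 0 by rewrite -normr_eq0 on oner_neq0.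
exists omega; split; first exact: o1.
move=> D E hD hE [_ sp1]; split; first exact: on.
move=> f f1 f_kill.
have invT t : alpha t @` cstarSubT A = cstarSubT A.
  apply/seteqP; split=> // a _; exists (aut_inv (alpha t) a) => //.
  exact: autVK.
have [phi [phi_oz phi_eq phi1]] := towers invT A_sep.
pose theta k : A -> A := alpha (int_pow g k).
have theta_hom k : star_hom (theta k) by exact: aut_hom.
have thetaE k : aut_pow (alpha g) k = theta k by exact: aut_pow_action.
have f_kill' a : E a -> zpartial (fun k => f k *: theta k a) @ \oo --> (0 : A).
  by move=> /f_kill; under eq_fun do rewrite thetaE.
(* If the rotated coefficients kill [E], then 1 being in the spectrum makes their transform vanish
   at 1, and this is the transform of [f] at [omega]. *)
suff F_kill a : E a ->
    zpartial (fun k => (f k * omega ^ k) *: theta k a) @ \oo --> (0 : A).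
  have -> : (fun n => f n * omega ^ n : R[i]^o) =
      (fun n => f n * omega ^ n * 1 ^ n : R[i]^o).
    by apply/funext => n; rewrite exp1rz mulr1.
  apply: (sp1 (fun k => f k * omega ^ k)) => [|a Ea]; last first.
    by under eq_fun do rewrite thetaE; exact: F_kill.
  rewrite /ell1; under eq_fun => k.
    rewrite normrM (_ : `|omega ^ k| = 1) ?mulr1; first over.
    by case: k => k; rewrite /exprz ?normfV normrX on expr1n ?invr1.
  exact: f1.
apply: (twisted_kills theta_hom f1 on) => a1 a2 a3 a4 w E1 E2 E3 E4 wP.
(* The unit of F(A, A) is the sum of the [phi l 1], so it suffices that each [phi l] of a delta
   function kills [w]. *)
apply: (unit_act_faithful A_sep phi1).
have phi_lin l (k : R[i]) u v : phi l (k *: u + v) = k *: phi l u + phi l v.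
  by have [[+ _] _ _] := phi_oz l; apply.
suff phi_w l : central_act (phi l (fun=> 1)) w = 0.
  elim/big_rec: _ => [|l q _ ih]; last by rewrite central_actD phi_w ih addr0.
  by rewrite -[0 in LHS](scale0r (0 : central_alg _)) central_actZ scale0r.
apply: (coset_span (L := fun u => central_act (phi l u) w) finH).
  by move=> k u v; rewrite phi_lin central_actD central_actZ.
move=> c; pose p := phi l (coset_delta R c).
have psa : adj p = p.
  have [[_ +] _ _] := phi_oz l => /(_ 1%N (const_mx (coset_delta R c))) [].
    exists (const_mx (coset_delta R c)) => i j; rewrite big_ord1 !mxE.
    by rewrite coset_delta_proj.
  move=> y /(_ ord0 ord0); rewrite big_ord1 !mxE -/p => ->.
  by rewrite adjM adjK.
pose u := orbit_wave g omega m c.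
pose q := phi l u.
have q_eig k : central_aut (invT (int_pow g k)) q = omega ^ k *: q.
  rewrite /q -phi_eq (coset_act_eigen_pow o0); last first.
    by apply: orbit_wave_eigen => //; exact: ltnW.
  have := phi_lin l (omega ^ k) u 0; rewrite addr0 => ->.
  have := phi_lin l (-1) 0 0; rewrite !scaleN1r oppr0 addr0 addNr => ->.
  by rewrite addr0.
(* Two successive lifts: [v] in the relative commutant inside [Ainf A], then [y] a bounded sequence
   in [A]. *)
pose v := val (qrepr q); pose y := val (qrepr v).
have vE : qpi (c0_ideal A) (qrepr v) = v := qreprK v.
have qw : central_act q w = 0.
  suff yw : (fun n => y n ** w) @ \oo --> (0 : A).
    rewrite /central_act -/v -vE -qpiM -(qpi0 (c0_ideal A)); apply/qpi_eq.
    by rewrite subr0; exact: yw.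
  apply: (twisted_limit_null theta_hom f1 hE hD f_kill' _ _ _ E1 E2 E3 E4 wP).
  - exact: (subAlg_in (qrepr v)).
  - move=> b; have := esym (subAlg_in (qrepr q) b I).
    by rewrite -/v -vE -!qpiM => /qpi_eq.
  (* The eigenvector equation holds modulo the annihilator of [A], hence in [Ainf A] only after
     multiplication by a constant [b]. *)
  - move=> k b; have := q_eig k.
    rewrite (_ : _ *: q = qpi _ (omega ^ k *: qrepr q)); last first.
      by rewrite qpiZ qreprK.
    move=> /qpi_eq/(_ b I)[+ _].
    rewrite raddfB linearZ /= -/v scalerN.
    rewrite (_ : _ *: v = qpi _ (omega ^ k *: qrepr v)); last first.
      by rewrite qpiZ qreprK.
    rewrite -qpiB -qpiM.
    by rewrite -(qpi0 (c0_ideal A)) => /qpi_eq; rewrite subr0.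
(* The term [j = 0] of [q] is [p]; the others are orthogonal to [p] by order zero, as [g^j c]
   differs from [c] for [0 < j < m]. *)
have pq : p ** q = p ** p.
  have phi0 : phi l 0 = 0.
    by have := phi_lin l (-1) 0 0; rewrite !scaleN1r oppr0 addr0 addNr.
  have phiS (r : seq 'I_m) (F : 'I_m -> cosets H -> R[i]^o) :
      phi l (\sum_(j <- r) F j) = \sum_(j <- r) phi l (F j).
    elim/big_rec2: _ => [//|j x1 x2 _ <-].
    by have := phi_lin l 1 (F j) x2; rewrite !scale1r.
  have phiZ (k : R[i]) z : phi l (k *: z) = k *: phi l z.
    by have := phi_lin l k z 0; rewrite phi0 !addr0.
  rewrite /q /u /orbit_wave phiS.
  rewrite (bigD1 (Ordinal (ltnW m1)))//= phiZ expr0 invr1 scale1r expg0.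
  rewrite coset_translate1 amulDr big_seq_cond.
  rewrite (_ : p ** \sum_(i <- _ | _) _ = 0) ?addr0//.
  elim/big_rec: _ => [|j z /andP[_ j0] ih]; first exact: amulr0.
  rewrite amulDr ih addr0 phiZ amulZr.
  have [_ _ oz] := phi_oz l.
  have [|-> _ _ _] := oz (coset_delta R c) (coset_delta R (coset_translate (g ^+ j)%g c)).
    apply: coset_delta_orth => /esym /(coset_translate_fix _ _ normalH).
    apply: m_min; rewrite ltn_ord andbT lt0n.
    by apply: contra j0 => /eqP j0; apply/eqP/val_inj.
  by rewrite scaler0.
(* [p^2 w = p (q w) = 0], and [p] is self-adjoint. *)
apply: central_act_sa_eq0 => //.
by rewrite -pq central_actM qw amulr0.
Qed.

End RokhlinTowers.

Theorem corollary5p8 (R : realType) (A : cstarAlgType R) (G : groupType)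
    (alpha : G -> starAut A) :
  separable [set: A] ->
  countable [set: G] ->
  amenable G R ->
  residually_finite G ->
  VRC G ->
  is_action alpha ->
  (dim_rok alpha < +oo)%E ->
  properly_outer_action alpha.
Proof.
move=> A_sep _ _ rf _ alpha_action dim_fin g g1 D [hD _ _] sp1.
have [H [normalH finH Hg]] := rf g g1.
(* Without towers the infimum would be over the empty set, that is [+oo]. *)
have [d towers] : exists d, rokhlin_towers alpha H d.
  apply: contrapT => /forallNP no_tower.
  have : (dim_rok_at alpha H < +oo)%E.
    by apply: le_lt_trans dim_fin; apply: ereal_sup_ubound; exists H.
  rewrite /dim_rok_at (_ : [set _ | d in _] = set0) ?ereal_inf0 ?ltxx//.
  by rewrite -subset0 => x [d /no_tower []].
have [omega [/eqP o1 rot]] :=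
  rokhlin_rotation A_sep alpha_action normalH finH towers Hg.
(* If the Borchers spectrum were [{1}], rotating 1 in each Arveson spectrum would put [omega] in it
   as well. *)
apply: o1; suff : borchers_sp (alpha g) D omega by rewrite sp1.
have : borchers_sp (alpha g) D 1 by rewrite sp1.
by move=> sp E hE; have [[hDE _ _] _] := hE; exact: rot hD hDE (sp E hE).
Qed.
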